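(* Assume $\Bbbk$ is uncountable. Let $M$ be a simple holonomic $A\mathcal{V}$-module. Then $M\cong P\otimes Q$ as $A\mathcal{V}$-modules, where $P$ is a simple holonomic $\mathcal{D}$-module and $Q$ is a simple finite-dimensional $\mathfrak{gl}_n$-module, regarded as an $\mathcal{L}_+$-module via $\mathcal{L}_+\to\mathcal{L}_0\cong\mathfrak{gl}_n$.
   Context: Setup: $\Bbbk$ algebraically closed, characteristic $0$; $A=\Bbbk[x_1,\dots,x_n]$; $\mathcal{V}=\mathrm{Der}(A)$. An $A\mathcal{V}$-module is an $A$-module and $\mathcal{V}$-module with $\eta(fm)=\eta(f)m+f(\eta m)$, i.e. a module over the smash product $A\#U(\mathcal{V})$. $\mathcal{D}$ is the Weyl algebra (subalgebra of $\mathrm{End}_\Bbbk(A)$ generated by $A$ and $\mathcal{V}$). $\mathcal{L}=\mathrm{Der}(\Bbbk[X_1,\dots,X_n])$, $\mathfrak{m}=(X_1,\dots,X_n)$, $\mathcal{L}_+=\mathfrak{m}\mathcal{L}=\bigoplus_{d\ge0}\mathcal{L}_d$ with $\mathcal{L}_d$ spanned by $X^k\partial/\partial X_i$, $|k|=d+1$; $\mathcal{L}_0\cong\mathfrak{gl}_n$ via $X_i\partial/\partial X_j\mapsto E_{ij}$, and $\mathcal{L}_+\to\mathcal{L}_0$ is the projection with kernel the ideal $\bigoplus_{d\ge1}\mathcal{L}_d$. There is an algebra isomorphism $\varphi:A\#U(\mathcal{V})\to\mathcal{D}\otimes U(\mathcal{L}_+)$, the natural embedding on $A$, with $\varphi(x^k\partial/\partial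 x_p)=x^k\partial/\partial x_p\otimes1+\sum_{0<m\le k}\binom{k}{m}x^{k-m}\otimes X^m\partial/\partial X_p$ (multi-index notation); via $\varphi$, $P\otimes Q$ is an $A\mathcal{V}$-module for any $\mathcal{D}$-module $P$ and $\mathcal{L}_+$-module $Q$. A finitely generated $A\mathcal{V}$-module is holonomic if it is $0$ or has Gelfand–Kirillov dimension $n$ over $A\#U(\mathcal{V})$; a finitely generated $\mathcal{D}$-module is holonomic if it is $0$ or has GK dimension $n$ over $\mathcal{D}$ (GK dimension of a module over a finitely generated algebra: $\limsup_m\log_m\dim(C^mM_0)$ for finite-dimensional generating subspaces $C\ni 1$, $M_0$). *)

(* Defs.v *)
From HB Require Import structures.
From mathcomp Require Import all_boot all_order all_algebra.
From mathcomp Require Import mpoly.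
From Stdlib Require Reals ClassicalEpsilon.
From Coquelicot Require Lim_seq Rbar Lub.

Set Implicit Arguments.
Unset Strict Implicit.
Unset Printing Implicit Defensive.

Import GRing.Theory.
Local Open Scope ring_scope.

Section Defs.
Variables (k : fieldType) (n : nat).

Definition Apoly := {mpoly k[n]}.

(* V = Der(A) = (+)_i A d/dx_i ; eta is represented by its coefficients
   eta = \sum_i eta_i d/dx_i *)
Definition Vder := {ffun 'I_n -> {mpoly k[n]}}.

Definition der (eta : Vder) (f : Apoly) : Apoly :=
  \sum_(i < n) eta i * mderiv i f.

Definition lieV (eta xi : Vder) : Vder :=
  [ffun j => der eta (xi j) - der xi (eta j)].

(* An AV-module: a k-vector space with an A-module structure and a
   V-module structure (V a Lie algebra), satisfying
   eta (f m) = eta(f) m + f (eta m);  i.e. a module over A # U(V). *)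
Record AVmod := {
  AVcar : lmodType k;
  actA : Apoly -> AVcar -> AVcar;
  actV : Vder -> AVcar -> AVcar;
  actA_linr : forall f (a : k) (u v : AVcar),
      actA f (a *: u + v) = a *: actA f u + actA f v;
  actA_linl : forall (a : k) f g (u : AVcar),
      actA (a *: f + g) u = a *: actA f u + actA g u;
  actA1 : forall u, actA 1 u = u;
  actAM : forall f g u, actA (f * g) u = actA f (actA g u);
  actV_linr : forall eta (a : k) (u v : AVcar),
      actV eta (a *: u + v) = a *: actV eta u + actV eta v;
  actV_linl : forall (a : k) eta xi (u : AVcar),
      actV (a *: eta + xi) u = a *: actV eta u + actV xi u;
  actV_lie : forall eta xi u,
      actV (lieV eta xi) u = actV eta (actV xi u) - actV xi (actV eta u);
  actAV : forall eta f u,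
      actV eta (actA f u) = actA (der eta f) u + actA f (actV eta u)
}.

Variable M : AVmod.
Local Notation MT := (AVcar M).

Definition submodule (N : MT -> Prop) : Prop :=
  [/\ N 0,
      (forall (a : k) u v, N u -> N v -> N (a *: u + v)),
      (forall f u, N u -> N (@actA M f u)) &
      (forall eta u, N u -> N (@actV M eta u))].

Definition simple_mod : Prop :=
  (exists u : MT, u != 0) /\
  forall N, submodule N -> (forall u, N u -> u = 0) \/ (forall u, N u).

Definition fin_gen : Prop :=
  exists gens : seq MT,
    forall N, submodule N -> (forall g, g \in gens -> N g) -> forall u, N u.

Definition asb (P : Prop) : bool :=
  if ClassicalEpsilon.excluded_middle_informative P then true else false.

Definition lin_indep (s : seq MT) : Prop :=
  forall c : 'I_(size s) -> k,
    \sum_(i < size s) c i *: s`_i = 0 -> forall i, c i = 0.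

Definition dimspan (s : seq MT) : nat :=
  \max_(b : (size s).-tuple bool | asb (lin_indep (mask b s))) count id b.

(* Given a finite subset C0 = fs U etas of A U V and a finite M0 subset M,
   words ops M0 m spans C^m M0 where C = span(1, C0). *)
Fixpoint words (ops : seq (MT -> MT)) (M0 : seq MT) (m : nat) : seq MT :=
  match m with
  | 0 => M0
  | m'.+1 => words ops M0 m' ++
             [seq op v | op <- ops, v <- words ops M0 m']
  end.

Definition opsof (fs : seq Apoly) (etas : seq Vder) : seq (MT -> MT) :=
  [seq @actA M f | f <- fs] ++ [seq @actV M eta | eta <- etas].

Definition gk_exponent (fs : seq Apoly) (etas : seq Vder) (M0 : seq MT)
    : Rbar.Rbar :=
  Lim_seq.LimSup_seq (fun m =>
    Rdefinitions.Rdiv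
      (Rpower.ln (Raxioms.INR (dimspan (words (opsof fs etas) M0 m))))
      (Rpower.ln (Raxioms.INR m))).

(* GKdim M = sup over finite-dimensional C (generated by finite subsets of
   the generating set A U V of the algebra) and finite-dimensional M0 of
   limsup_m log_m dim (C^m M0). *)
Definition GKdim : Rbar.Rbar :=
  Lub.Rbar_lub (fun x => exists fs etas M0, x = gk_exponent fs etas M0).

Definition holonomic : Prop :=
  (forall u : MT, u = 0) \/
  (fin_gen /\ GKdim = Rbar.Finite (Raxioms.INR n)).

(* M is a D-module: the action of A # U(V) factors through the Weyl algebra
   D, i.e. the vector field f*eta acts as the composite f o eta. *)
Definition is_Dmod : Prop :=
  forall (f : Apoly) (eta : Vder) u,
    @actV M [ffun i => f * eta i] u = @actA M f (@actV M eta u).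

End Defs.
Arguments actA {k n} _ _ _.
Arguments actV {k n} _ _ _.

Section Gl.
Variables (k : fieldType) (n d : nat).

Definition gl_rep (rho : 'M[k]_n -> 'M[k]_d) : Prop :=
  (forall (a : k) X Y, rho (a *: X + Y) = a *: rho X + rho Y) /\
  (forall X Y, rho (X *m Y - Y *m X) = rho X *m rho Y - rho Y *m rho X).

(* simple: k^d <> 0 and the only invariant subspaces are 0 and k^d
   (subspaces are row spaces of transposed column vectors) *)
Definition gl_simple (rho : 'M[k]_n -> 'M[k]_d) : Prop :=
  (0 < d)%N /\
  forall U : 'M[k]_d, (forall X, stablemx U (rho X)^T) ->
    (U == (0 : 'M[k]_d))%MS || row_full U.

(* the image of X^m d/dX_p in L_0 = gl_n under L_+ -> L_0
   (X^m d/dX_p with |m| = 1, m = e_i, maps to E_ip; |m| >= 2 maps to 0) *)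
Definition projL0 (m : 'X_{1..n}) (p : 'I_n) : 'M[k]_n :=
  if mdeg m == 1%N then \matrix_(i, j) (((m i)%:R : k) * (j == p)%:R) else 0.
End Gl.

Section Tensor.
Variables (k : fieldType) (n d : nat) (P : AVmod k n)
          (rho : 'M[k]_n -> 'M[k]_d).
Local Notation PT := (AVcar P).

(* P (x) k^d is identified with 'I_d -> P: u <-> \sum_j u j (x) e_j *)
Definition tensA (f : Apoly k n) (u : 'I_d -> PT) : 'I_d -> PT :=
  fun i => actA P f (u i).

Definition tens_op (g : Apoly k n) (B : 'M[k]_d) (u : 'I_d -> PT)
    : 'I_d -> PT :=
  fun i => \sum_(j < d) B i j *: actA P g (u j).

(* phi(x^K d/dx_p) = x^K d/dx_p (x) 1
      + \sum_{0 < m <= K} binom(K,m) x^(K-m) (x) X^m d/dX_p,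
   extended linearly; Q is an L_+-module through L_+ -> L_0 = gl_n.
   The sum over m ranges over all monomials of degree <= |K|; the binomial
   coefficient \prod_i C(K_i, m_i) vanishes unless m <= K. *)
Definition tensV (eta : Vder k n) (u : 'I_d -> PT) : 'I_d -> PT :=
  fun i => actV P eta (u i) +
    \sum_(p < n) \sum_(K <- msupp (eta p))
      \sum_(m : 'X_{1..n < (mdeg K).+1} | m != 0%MM :> 'X_{1..n})
        (eta p)@_K *:
          ((\prod_(l < n) 'C(K l, m l))%:R *:
             tens_op 'X_[(K - m)%MM] (rho (projL0 k m p)) u i).

Definition AV_iso_tensor (M : AVmod k n) (F : AVcar M -> 'I_d -> PT) : Prop :=
  [/\ (forall (a : k) u v i, F (a *: u + v) i = a *: F u i + F v i),
      injective F,
      (forall w : 'I_d -> PT, exists u, F u = w),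
      (forall f u, F (actA M f u) = tensA f (F u)) &
      (forall eta u, F (actV M eta u) = tensV eta (F u))].
End Tensor.

(* Main.v *)
Require Import Defs.

(* Write A # U(V) = D (x) U(L_+). The copy of L_0 = gl_n acts on M by operators
   [glop i j] commuting with D. If U(gl_n) u were infinite dimensional for some
   u <> 0, the words of length <= s in gl_n applied to u would span a space of
   dimension > s, and Bernstein's argument (an operator of the Weyl algebra
   killing all short words on u is zero, by taking commutators with x_i and
   d/dx_i) would give M growth at least n + 1/2. So M contains a finite
   dimensional simple gl_n-submodule W; let v in W be an eigenvector of the
   Euler field, with eigenvalue lam. The operators of L_d raise eigenvalues by d,
   so the eigenspaces for lam + 1, lam + 2, ... span a proper submodule, which
   is 0; hence L_d v = 0 for d >= 1, and therefore L_d M = 0. By Burnside's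
   theorem the image of U(gl_n) in End(M) is a matrix algebra, its matrix units
   E_ab split M as (E_00 M) (x) W, and P = E_00 M is the required D-module; its
   growth is at least n by Bernstein's inequality and at most that of M. *)

(** The half in n + 1/2 comes from a square root. The (s+1)^(2n) Weyl monomials, times more than s
    independent operators coming from gl_n, are independent as maps between two spaces of words, so
    their number is at most the square of the dimension of the larger space. The isomorphism with D
    (x) U(L_+) is not built. The elements X^m d/dX_p with |m| >= 2 enter only through the Taylor
    remainders [theta f p], which commute with A but mix several degrees with polynomial
    coefficients. Reading [psi f p] as (f(x+X) - f(x)) d/dX_p explains all bracket formulas, and
    arguments on the Euler grading become inductions on |m| with lower monomials as corrections. Nor
    is U(gl_n) built: the relation [represents] links an operator on M to a matrix on W, and
    simplicity of M makes this correspondence one to one. *)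

Module Growth.
From Stdlib Require Import Reals Lra Lia.
From Coquelicot Require Import Coquelicot.
Local Open Scope R_scope.

(** * Growth exponents as limits superior *)

Definition growth (d : nat -> nat) : Rbar :=
  LimSup_seq (fun m => ln (INR (d m)) / ln (INR m)).

Lemma limsup_le_eventually (u : nat -> R) (l eps : R) :
  Rbar_le (LimSup_seq u) l -> 0 < eps ->
  exists N, forall m, (N <= m)%nat -> u m < l + eps.
Proof.
intros Hl He; destruct (ex_LimSup_seq u) as [x Hx].
rewrite (is_LimSup_seq_unique _ _ Hx) in Hl.
destruct x as [x| |]; simpl in Hl; [|easy|].
- destruct (Hx (mkposreal _ He)) as [_ [N HN]]; exists N; intros m Hm.
  specialize (HN m Hm); simpl in HN; lra.
- destruct (Hx (l + eps)) as [N HN]; exists N; exact HN.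
Qed.

Lemma eventually_limsup_le (u : nat -> R) (l : R) :
  (forall eps, 0 < eps -> exists N, forall m, (N <= m)%nat -> u m <= l + eps) ->
  Rbar_le (LimSup_seq u) l.
Proof.
intros H; destruct (ex_LimSup_seq u) as [x Hx].
rewrite (is_LimSup_seq_unique _ _ Hx); destruct x as [x| |]; simpl; [| |easy].
- apply Rnot_lt_le; intros Hlt.
  assert (He : 0 < (x - l) / 2) by lra.
  destruct (H _ He) as [N HN]; destruct (Hx (mkposreal _ He)) as [H1 _].
  destruct (H1 N) as [m [Hm Hm']]; specialize (HN m Hm); simpl in Hm'; lra.
- destruct (H 1 Rlt_0_1) as [N HN]; destruct (Hx (l + 1) N) as [m [Hm Hm']].
  specialize (HN m Hm); lra.
Qed.

Lemma frequently_le_limsup (u : nat -> R) (l : R) :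
  (forall eps N, 0 < eps -> exists m, (N <= m)%nat /\ l - eps <= u m) ->
  Rbar_le l (LimSup_seq u).
Proof.
intros H; destruct (ex_LimSup_seq u) as [x Hx].
rewrite (is_LimSup_seq_unique _ _ Hx); destruct x as [x| |]; simpl; [|easy|].
- apply Rnot_lt_le; intros Hlt.
  assert (He : 0 < (l - x) / 3) by lra.
  destruct (Hx (mkposreal _ He)) as [_ [N HN]].
  destruct (H _ N He) as [m [Hm Hm']]; specialize (HN m Hm); simpl in HN; lra.
- destruct (Hx (l - 1)) as [N HN].
  destruct (H 1 N Rlt_0_1) as [m [Hm Hm']]; specialize (HN m Hm); lra.
Qed.

Lemma ln_INR_ge0 (m : nat) : 0 <= ln (INR m).
Proof.
destruct m as [|m].
(* [ln] takes the value 0 outside the positive reals, in particular at 0. *)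
- simpl; unfold ln; destruct (Rlt_dec 0 0); [exfalso; lra|lra].
- rewrite <- ln_1; apply ln_le; [lra|]; rewrite S_INR; pose proof (pos_INR m); lra.
Qed.

Lemma ln_INR_gt0 (m : nat) : (2 <= m)%nat -> 0 < ln (INR m).
Proof.
intros H; rewrite <- ln_1; apply ln_increasing; [lra|].
apply le_INR in H; simpl in H; lra.
Qed.

Lemma ln_INR_le (a b : nat) : (a <= b)%nat -> ln (INR a) <= ln (INR b).
Proof.
destruct a as [|a]; intros H.
- simpl (INR 0); unfold ln at 1; destruct (Rlt_dec 0 0); [exfalso; lra|].
  apply ln_INR_ge0.
- apply ln_le; [apply lt_0_INR; lia|apply le_INR; exact H].
Qed.

Lemma ln_INR_mult (a b : nat) : (0 < a)%nat -> (0 < b)%nat ->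
  ln (INR (a * b)) = ln (INR a) + ln (INR b).
Proof. intros; rewrite mult_INR; apply ln_mult; apply lt_0_INR; lia. Qed.

Lemma ln_INR_pow (a e : nat) : (0 < a)%nat ->
  ln (INR (a ^ e)) = INR e * ln (INR a).
Proof.
intros Ha; rewrite pow_INR; apply ln_pow; apply lt_0_INR; lia.
Qed.

Lemma ln_INR_unbounded (C : R) (N : nat) :
  exists s, (N <= s)%nat /\ (1 <= s)%nat /\ C <= ln (INR s).
Proof.
destruct (INR_unbounded (exp C)) as [s0 Hs0].
exists (Nat.max (Nat.max N s0) 1); repeat split; try lia.
rewrite <- (ln_exp C); apply ln_le; [apply exp_pos|].
apply Rlt_le, Rlt_le_trans with (INR s0); [lra|]; apply le_INR; lia.
Qed.

(** Doubling the word length only adds ln 2 to ln m. This covers a passage between modules in which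
    one letter becomes two. *)
Lemma growth_le_double (d d' : nat -> nat) (l : R) : 0 <= l ->
  (forall m, (d m <= d' (2 * m))%nat) ->
  Rbar_le (growth d') l -> Rbar_le (growth d) l.
Proof.
intros Hl0 Hd Hl; apply eventually_limsup_le; intros eps He.
destruct (limsup_le_eventually _ _ (eps / 2) Hl) as [N HN]; [lra|].
(* Beyond this threshold the contribution of ln 2 is at most (eps / 2) ln m. *)
destruct (ln_INR_unbounded ((l + eps / 2) * ln 2 / (eps / 2)) 2) as [s [Hs2 [_ Hs]]].
exists (Nat.max N s); intros m Hm.
assert (Hlm := ln_INR_gt0 m ltac:(lia)).
assert (Hl2m := ln_INR_gt0 (2 * m) ltac:(lia)).
apply Rmult_le_reg_r with (ln (INR m)); [exact Hlm|].
unfold Rdiv at 1; rewrite Rmult_assoc, Rinv_l, Rmult_1_r; [|lra].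
apply Rle_trans with (1 := ln_INR_le _ _ (Hd m)).
specialize (HN (2 * m)%nat ltac:(lia)); simpl in HN.
apply (Rmult_lt_compat_r _ _ _ Hl2m) in HN.
unfold Rdiv in HN at 1; rewrite Rmult_assoc, Rinv_l, Rmult_1_r in HN; [|lra].
apply Rlt_le, Rlt_le_trans with (1 := HN).
change (m + (m + 0))%nat with (2 * m)%nat.
rewrite ln_INR_mult by lia; replace (INR 2) with 2 by (simpl; lra).
assert (Hsm := ln_INR_le s m ltac:(lia)).
assert (H : (l + eps / 2) * ln 2 <= eps / 2 * ln (INR m)).
{ apply Rle_trans with (eps / 2 * ((l + eps / 2) * ln 2 / (eps / 2))).
  - right; field; lra.
  - apply Rmult_le_compat_l; lra. }
lra.
Qed.

(** A limit superior is bounded below along the subsequence q s alone, and the constant ln q is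
    negligible against ln s. The square on the right halves the exponent. *)
Lemma half_power_le_growth (d : nat -> nat) (p q : nat) : (2 <= q)%nat ->
  (forall s, (S s ^ p <= d (q * s) ^ 2)%nat) ->
  Rbar_le (INR p / 2) (growth d).
Proof.
intros Hq Hd; apply frequently_le_limsup; intros eps N He.
assert (Hlq := ln_INR_gt0 q Hq).
destruct (ln_INR_unbounded (INR p / 2 * ln (INR q) / eps) N) as [s [HsN [Hs1 Hs]]].
exists (q * s)%nat; split; [nia|].
assert (Hlqs := ln_INR_gt0 (q * s) ltac:(nia)).
assert (Hls := ln_INR_ge0 s).
apply Rmult_le_reg_r with (ln (INR (q * s))); [exact Hlqs|].
unfold Rdiv at 2; rewrite Rmult_assoc, Rinv_l, Rmult_1_r; [|lra].
assert (Hdp : (0 < d (q * s))%nat).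
{ specialize (Hd s); destruct (d (q * s)%nat); [|lia].
  assert (S s ^ p <> 0)%nat by (apply Nat.pow_nonzero; lia); simpl in Hd; lia. }
assert (H := ln_INR_le _ _ (Hd s)).
rewrite (ln_INR_pow (d _)), ln_INR_pow in H by lia; change (INR 2) with (1 + 1) in H.
assert (Hss := ln_INR_le s (S s) ltac:(lia)).
assert (H1 : INR p * ln (INR s) <= INR p * ln (INR (S s)))
  by (apply Rmult_le_compat_l; [apply pos_INR|exact Hss]).
rewrite ln_INR_mult by lia.
assert (H2 : INR p / 2 * ln (INR q) <= eps * ln (INR s)).
{ apply Rle_trans with (eps * (INR p / 2 * ln (INR q) / eps)).
  - right; field; lra.
  - apply Rmult_le_compat_l; lra. }
assert (H3 : 0 <= eps * ln (INR q)) by (apply Rmult_le_pos; lra).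
lra.
Qed.

End Growth.

From HB Require Import structures.
From mathcomp Require Import all_boot all_order all_algebra.
From mathcomp Require Import mpoly.
From Stdlib Require FunctionalExtensionality Lra.
Import GRing.Theory.
Local Open Scope ring_scope.

Set Implicit Arguments.
Unset Strict Implicit.
Unset Printing Implicit Defensive.

(** * Linear algebra *)

Definition linop (k : fieldType) (V W : lmodType k) (f : V -> W) :=
  forall (a : k) u v, f (a *: u + v) = a *: f u + f v.

Section LinearMaps.
Variables (k : fieldType) (V W : lmodType k) (f : V -> W).
Hypothesis fL : linop f.
Implicit Types u v : V.

Lemma linopD u v : f (u + v) = f u + f v.
Proof. by have := fL 1 u v; rewrite !scale1r. Qed.

Lemma linop0 : f 0 = 0.
Proof. by apply: (addIr (f 0)); rewrite -linopD !addr0 add0r. Qed.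

Lemma linopZ a u : f (a *: u) = a *: f u.
Proof. by rewrite -[a *: u]addr0 fL linop0 addr0. Qed.

Lemma linopN u : f (- u) = - f u.
Proof. by rewrite -scaleN1r linopZ scaleN1r. Qed.

Lemma linopB u v : f (u - v) = f u - f v.
Proof. by rewrite linopD linopN. Qed.

Lemma linop_sum (I : Type) (r : seq I) (P : pred I) (F : I -> V) :
  f (\sum_(i <- r | P i) F i) = \sum_(i <- r | P i) f (F i).
Proof. by apply: big_morph; [exact: linopD | exact: linop0]. Qed.

Lemma linop_comb (I : finType) (c : I -> k) (w : I -> V) :
  f (\sum_i c i *: w i) = \sum_i c i *: f (w i).
Proof. by rewrite linop_sum; apply: eq_bigr => i _; rewrite linopZ. Qed.
End LinearMaps.

Section LinearAlgebra.
Variables (k : fieldType) (V : lmodType k).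
Implicit Types (u v x : V) (b s : seq V) (f g : V -> V).

Definition subspace (N : V -> Prop) :=
  N 0 /\ forall (a : k) u v, N u -> N v -> N (a *: u + v).
Definition inspan b v :=
  exists c : 'I_(size b) -> k, v = \sum_(i < size b) c i *: b`_i.
Definition indep (I : finType) (w : I -> V) :=
  forall c : I -> k, \sum_i c i *: w i = 0 -> forall i, c i = 0.

Lemma linop_iter f e : linop f -> linop (iter e f).
Proof. by move=> fL; elim: e => [|e IH] a u v //=; rewrite IH fL. Qed.

Lemma linop_comp f g : linop f -> linop g -> linop (fun v => f (g v)).
Proof. by move=> fL gL a u v; rewrite gL fL. Qed.

Lemma linopD_op f g : linop f -> linop g -> linop (fun v => f v + g v).
Proof. by move=> fL gL a u v; rewrite gL fL scalerDr addrACA. Qed.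

Lemma linopZ_op (c : k) f : linop f -> linop (fun v => c *: f v).
Proof.
by move=> fL a u v; rewrite fL scalerDr !scalerA mulrC.
Qed.

Lemma linop_sum_op (I : finType) (F : I -> V -> V) :
  (forall i, linop (F i)) -> linop (fun v => \sum_i F i v).
Proof.
move=> FL a u v; rewrite scaler_sumr -big_split /=.
by apply: eq_bigr => i _; rewrite FL.
Qed.

Lemma subspace_sum N (I : Type) (r : seq I) (P : pred I) (F : I -> V) :
  subspace N -> (forall i, P i -> N (F i)) -> N (\sum_(i <- r | P i) F i).
Proof.
move=> [N0 NL] NF; elim/big_ind: _ => // u v Nu Nv.
by rewrite -[u]scale1r; apply: NL.
Qed.

Lemma subspaceZ N a u : subspace N -> N u -> N (a *: u).
Proof. by move=> [N0 NL] Nu; rewrite -[a *: u]addr0; apply: NL. Qed.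

Lemma subspaceD N u v : subspace N -> N u -> N v -> N (u + v).
Proof. by move=> [N0 NL] Nu Nv; rewrite -[u]scale1r; apply: NL. Qed.

Lemma subspaceB N u v : subspace N -> N u -> N v -> N (u - v).
Proof.
by move=> NS Nu Nv; apply: subspaceD => //; rewrite -scaleN1r; apply: subspaceZ.
Qed.

Lemma inspan_subspace b : subspace (inspan b).
Proof.
split=> [|a u v [c ->] [d ->]].
  by exists (fun=> 0); rewrite big1 // => i _; rewrite scale0r.
exists (fun i => a * c i + d i); rewrite scaler_sumr -big_split /=.
by apply: eq_bigr => i _; rewrite scalerDl scalerA.
Qed.

Lemma mem_inspan b x : x \in b -> inspan b x.
Proof.
move=> xb; have ib : (index x b < size b)%N by rewrite index_mem.
exists (fun i => (i == Ordinal ib)%:R); rewrite (bigD1 (Ordinal ib)) //= eqxx.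
rewrite scale1r nth_index // big1 ?addr0 // => i /negPf ->.
by rewrite scale0r.
Qed.

Lemma inspan_min N b v :
  subspace N -> (forall x, x \in b -> N x) -> inspan b v -> N v.
Proof.
move=> NS Nb [c ->]; apply: subspace_sum => // i _.
by apply: subspaceZ => //; apply: Nb; rewrite mem_nth.
Qed.

Lemma inspan_trans b s v :
  (forall x, x \in b -> inspan s x) -> inspan b v -> inspan s v.
Proof. exact: inspan_min (inspan_subspace s). Qed.

Lemma linop_eq_on_span f b v : linop f ->
  (forall x, x \in b -> f x = 0) -> inspan b v -> f v = 0.
Proof.
move=> fL; apply: (@inspan_min (fun v => f v = 0)); split.
  exact: linop0.
by move=> a x y fx fy; rewrite fL fx fy scaler0 addr0.
Qed.

Lemma card_le_of_free (I J : finType) (C : I -> J -> k) :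
  (forall c : I -> k, (forall j, \sum_i c i * C i j = 0) -> forall i, c i = 0) ->
  (#|I| <= #|J|)%N.
Proof.
move=> Cfree; pose A := \matrix_(i < #|I|, j < #|J|) C (enum_val i) (enum_val j).
suff /eqP <- : row_free A by apply: rank_leq_col.
apply: inj_row_free => x xA.
have H := Cfree (fun i => x 0 (enum_rank i)) _.
apply/rowP => i; rewrite mxE -[i]enum_valK; apply: H => j.
have /rowP/(_ (enum_rank j)) := xA; rewrite !mxE => xAj; apply: etrans xAj.
rewrite [RHS](reindex (@enum_rank I)) /=; last exact/onW_bij/enum_rank_bij.
by apply: eq_bigr => l _; rewrite mxE !enum_rankK.
Qed.

Lemma indep_card (I : finType) (w : I -> V) b :
  indep w -> (forall i, inspan b (w i)) -> (#|I| <= size b)%N.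
Proof.
move=> wfree /fin_all_exists[C wC]; rewrite -[size b]card_ord.
apply: (@card_le_of_free _ _ C) => c Hc; apply: wfree.
under eq_bigr => i _ do rewrite wC scaler_sumr.
rewrite exchange_big /= big1 // => j _.
by under eq_bigr => i _ do rewrite scalerA; rewrite -scaler_suml Hc scale0r.
Qed.

(* The coefficients of the [p i] are linearly independent in the space of
   matrices of size [size b] x [size s]. *)
Lemma indep_ops_card (I : finType) (p : I -> V -> V) b s :
  (forall i x, x \in b -> inspan s (p i x)) ->
  (forall c : I -> k, (forall x, x \in b -> \sum_i c i *: p i x = 0) ->
     forall i, c i = 0) ->
  (#|I| <= size b * size s)%N.
Proof.
move=> pbs pfree.
have /fin_all_exists[C pC] (i : I) :
  exists c : 'I_(size b) -> 'I_(size s) -> k,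
    forall l : 'I_(size b), p i b`_l = \sum_j c l j *: s`_j.
  have [l|C pC] := @fin_all_exists _ _ (fun (l : 'I_(size b)) (c : 'I_(size s) -> k) =>
    p i b`_l = \sum_j c j *: s`_j); last by exists C.
  by apply: pbs; rewrite mem_nth.
have -> : (size b * size s = #|{: 'I_(size b) * 'I_(size s)}|)%N.
  by rewrite card_prod !card_ord.
apply: (@card_le_of_free _ _ (fun i lj => C i lj.1 lj.2)) => c Hc.
apply: pfree => x /(nthP 0)[l lb <-].
under eq_bigr => i _ do rewrite (pC i (Ordinal lb)) scaler_sumr.
rewrite exchange_big /= big1 // => j _.
under eq_bigr => i _ do rewrite scalerA.
by rewrite -scaler_suml (Hc (Ordinal lb, j)) scale0r.
Qed.

Lemma indep_cons x b : ~ inspan b x -> indep (fun i : 'I_(size b) => b`_i) ->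
  indep (fun i : 'I_(size (x :: b)) => (x :: b)`_i).
Proof.
move=> xb bfree c; rewrite big_ord_recl /=.
under eq_bigr => i _ do rewrite /bump /=.
have [c0 | c0] := eqVneq (c ord0) 0.
  rewrite c0 scale0r add0r => /bfree cb i.
  by have [j ->|->] := unliftP (ord0 : 'I_(size b).+1) i; first exact: cb.
move=> H; case: xb; exists (fun i => - (c ord0)^-1 * c (lift ord0 i)).
apply: (scalerI c0); rewrite scaler_sumr.
under eq_bigr => i _ do rewrite scalerA mulrA mulrN mulfV // mulN1r scaleNr.
by rewrite sumrN; apply/eqP; rewrite -addr_eq0 H.
Qed.

(** An entry is kept when it is not in the span of those kept after it. The basis is given as a mask
    because [dimspan] maximises over masks. *)
Lemma exists_basis_mask s : exists m : bitseq, [/\ size m = size s,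
  indep (fun i : 'I_(size (mask m s)) => (mask m s)`_i) &
  forall x, x \in s -> inspan (mask m s) x].
Proof.
elim: s => [|y s [m [sm mfree ms]]].
  by exists [::]; split=> // c _ [].
have [yms|yms] := ClassicalEpsilon.excluded_middle_informative (inspan (mask m s) y).
  exists (false :: m); split=> //=; first by rewrite sm.
  by move=> x; rewrite inE => /predU1P[->|/ms].
exists (true :: m); split=> //=; first by rewrite sm.
  exact: indep_cons.
move=> x; rewrite inE => /predU1P[->|xs]; first by apply: mem_inspan; rewrite mem_head.
by apply: inspan_trans (ms x xs) => z zm; apply: mem_inspan; rewrite inE zm orbT.
Qed.
End LinearAlgebra.

Lemma subspace_preim (k : fieldType) (V W : lmodType k) (f : V -> W) (N : W -> Prop) :
  linop f -> subspace N -> subspace (fun v => N (f v)).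
Proof.
move=> fL [N0 NL]; split; first by rewrite linop0.
by move=> a u v Nu Nv; rewrite fL; apply: NL.
Qed.

Lemma asbP (P : Prop) : reflect P (asb P).
Proof.
by rewrite /asb; case: ClassicalEpsilon.excluded_middle_informative => ?; constructor.
Qed.

(** * The dimension of the span of a list *)

Section Dimspan.
Variables (k : fieldType) (n : nat) (M : AVmod k n).
Implicit Types s b : seq (AVcar M).

Lemma dimspan_basis s : exists b, [/\ size b = dimspan s,
  indep (fun i : 'I_(size b) => b`_i), {subset b <= s} &
  forall x, x \in s -> inspan b x].
Proof.
have [m [sm mfree ms]] := exists_basis_mask s.
exists (mask m s); split=> //; last by move=> x /mem_mask.
apply/eqP; rewrite eqn_leq; apply/andP; split.
  rewrite size_mask //; have sm' : size m == size s by apply/eqP.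
  rewrite /dimspan; apply: (bigmax_sup (Tuple sm')) => //=.
  exact/asbP.
apply/bigmax_leqP => t /asbP tfree.
rewrite -(size_mask (s := s)) ?size_tuple // -[X in (X <= _)%N]card_ord.
apply: indep_card tfree _ => i; apply: ms.
by apply: (mem_mask (m := t)); rewrite mem_nth.
Qed.

Lemma indep_le_dimspan (I : finType) (w : I -> AVcar M) s :
  indep w -> (forall i, inspan s (w i)) -> (#|I| <= dimspan s)%N.
Proof.
move=> wfree ws; have [b [<- _ _ sb]] := dimspan_basis s.
by apply: indep_card wfree _ => i; apply: inspan_trans (ws i).
Qed.
End Dimspan.

(** * A reflexive tactic for identities in abelian groups *)

Inductive zexp := ZVar of nat | ZAdd of zexp & zexp | ZOpp of zexp | ZNil.

Fixpoint zeval (U : zmodType) (env : seq U) e : U :=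
  match e with
  | ZVar i => env`_i
  | ZAdd e1 e2 => zeval env e1 + zeval env e2
  | ZOpp e1 => - zeval env e1
  | ZNil => 0
  end.

Fixpoint zcoef e (i : nat) : int :=
  match e with
  | ZVar j => (i == j)%:Z
  | ZAdd e1 e2 => zcoef e1 i + zcoef e2 i
  | ZOpp e1 => - zcoef e1 i
  | ZNil => 0
  end.

Lemma zevalE (U : zmodType) (env : seq U) e :
  zeval env e = \sum_(i < size env) env`_i *~ zcoef e i.
Proof.
elim: e => [j|e1 IH1 e2 IH2|e IH|] /=.
- have [jl|jl] := ltnP j (size env); last first.
    rewrite nth_default // big1 // => i _.
    by rewrite ltn_eqF ?mulr0z // (leq_trans (ltn_ord i)).
  rewrite (bigD1 (Ordinal jl)) //= eqxx mulr1z big1 ?addr0 // => i.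
  by rewrite -val_eqE /= => /negPf ->; rewrite mulr0z.
- by rewrite IH1 IH2 -big_split; apply: eq_bigr => i _; rewrite mulrzDr.
- by rewrite IH -sumrN; apply: eq_bigr => i _; rewrite mulrNz.
- by rewrite big1 // => i _; rewrite mulr0z.
Qed.

Lemma zeval_eq (U : zmodType) (env : seq U) (m : nat) e1 e2 : size env = m ->
  all (fun i => zcoef e1 i == zcoef e2 i) (iota 0 m) ->
  zeval env e1 = zeval env e2.
Proof.
move=> <- /allP E; rewrite !zevalE; apply: eq_bigr => i _; congr (_ *~ _).
by apply/eqP/E; rewrite mem_iota leq0n add0n ltn_ord.
Qed.

(* Atoms are compared up to conversion, since the scaling operation occurs
   under several canonical structures. *)
Ltac zindex x env :=
  lazymatch env with
  | ?y :: ?env' =>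
    match constr:(tt) with
    | _ => let _ := match constr:(tt) with _ => unify x y end in constr:(0%N)
    | _ => let i := zindex x env' in constr:(i.+1)
    end
  end.
Ltac zinsert x env :=
  match constr:(tt) with
  | _ => let _ := zindex x env in env
  | _ => constr:(x :: env)
  end.
Ltac zatoms t env :=
  lazymatch t with
  | @GRing.add _ ?a ?b => let env := zatoms a env in zatoms b env
  | @GRing.opp _ ?a => zatoms a env
  | @GRing.zero _ => env
  | _ => zinsert t env
  end.
Ltac zreify t env :=
  lazymatch t with
  | @GRing.add _ ?a ?b =>
      let a := zreify a env in let b := zreify b env in constr:(ZAdd a b)
  | @GRing.opp _ ?a => let a := zreify a env in constr:(ZOpp a)
  | @GRing.zero _ => constr:(ZNil)
  | _ => let i := zindex t env in constr:(ZVar i)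
  end.
Ltac zmodule :=
  lazymatch goal with
  | |- @eq ?T ?a ?b =>
    let env := zatoms a (@nil T) in
    let env := zatoms b env in
    let ea := zreify a env in let eb := zreify b env in
    let m := eval cbv beta iota delta [size] in (size env) in
    apply: (@zeval_eq _ env m ea eb (erefl _)); vm_compute; reflexivity
  end.

(** * Bernstein's inequality *)

Section Bernstein.
Variables (k : fieldType) (char0 : [pchar k] =i pred0) (V : lmodType k).
Implicit Types (u v : V) (K H : nat -> V -> Prop).

Lemma natr_neq0 (m : nat) : (m.+1)%:R != 0 :> k.
Proof. by rewrite ((pcharf0P k).1 char0). Qed.

Section Commutator.
Variables (y y' : V -> V) (kap : k) (K : nat -> V -> Prop).
Hypotheses (yL : linop y) (y'L : linop y') (kap0 : kap != 0).
Hypothesis yy' : forall v, y' (y v) = y (y' v) + kap *: v.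
Hypothesis KS : forall m v, K m v -> K m.+1 v.
Hypothesis Ky' : forall m v, K m v -> K m.+1 (y' v).

Lemma commutator_iter e v :
  y' (iter e y v) = iter e y (y' v) + (e%:R * kap) *: iter e.-1 y v.
Proof.
elim: e => [|e IH] /=; first by rewrite mul0r scale0r addr0.
rewrite yy' IH (linopD yL) (linopZ yL) -addrA; congr (_ + _).
case: e {IH} => [|e]; first by rewrite mul0r scale0r add0r mul1r.
by rewrite /= -scalerDl -[in RHS]natr1 mulrDl mul1r.
Qed.

(* Commuting with [y'] differentiates the polynomial [\sum_e y ^ e z_e] and
   shortens by one the words it is known to kill. *)
Lemma kill_coefficients t r (z : nat -> V -> V) :
  (forall e v, y' (z e v) = z e (y' v)) ->
  (forall v, K (t + r) v -> \sum_(e < t.+1) iter e y (z e v) = 0) ->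
  forall e v, (e <= t)%N -> K r v -> z e v = 0.
Proof.
elim: t z => [|t IH] z zy' zK e v.
  by rewrite leqn0 => /eqP -> /zK; rewrite big_ord1.
(* The coefficients of the derivative are (e+1) kap z_(e+1); the induction hypothesis kills them,
   and e+1 is invertible in characteristic 0. *)
have zS e' w : (e' <= t)%N -> K r w -> z e'.+1 w = 0.
  move=> e't Kw; apply: (@scalerI _ _ (e'.+1%:R * kap)).
    by rewrite mulf_neq0 // natr_neq0.
  rewrite scaler0.
  apply: (IH (fun e w => (e.+1%:R * kap) *: z e.+1 w)) e't Kw.
    by move=> e1 v1; rewrite (linopZ y'L) zy'.
  move=> {w} w Kw.
  have E1 := zK _ (KS Kw); have E2 := zK _ (Ky' Kw).
  (* Subtracting the relation at [y' w] from [y'] of the relation at [w] cancels all y^e z_e y' w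
     and leaves the derivative. *)
  have: y' (\sum_(e < t.+2) iter e y (z e w)) -
      \sum_(e < t.+2) iter e y (z e (y' w)) = 0.
    by rewrite E1 [X in _ - X]E2 (linop0 y'L) subrr.
  rewrite (linop_sum y'L) -sumrB big_ord_recl /= zy' subrr add0r => E.
  apply: etrans E; apply: eq_bigr => i _.
  rewrite /bump leq0n !add0n !add1n -!iterS commutator_iter zy' addrC addKr /=.
  by rewrite (linopZ (linop_iter _ yL)).
case: e => [|e] ele Kv; last exact: zS.
have Kv' : K (t.+1 + r) v.
  by elim: (t.+1) => [|m Km] //; rewrite addSn; apply: KS.
have := zK _ Kv'; rewrite big_ord_recl big1 ?addr0 // => i _.
rewrite lift0 zS //; last by rewrite -ltnS.
exact/linop0/linop_iter.
Qed.
End Commutator.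

Section Family.
Variables (N s : nat) (y y' : 'I_N -> V -> V) (kap : 'I_N -> k).
Variables (K H : nat -> V -> Prop) (c : nat).
Hypotheses (yL : forall l, linop (y l)) (y'L : forall l, linop (y' l)).
Hypothesis kap0 : forall l, kap l != 0.
Hypothesis yy' : forall l v, y' l (y l v) = y l (y' l v) + kap l *: v.
Hypothesis y'C : forall (l j : 'I_N) v, (l < j)%N -> y' j (y l v) = y l (y' j v).
Hypothesis KS : forall m v, K m v -> K m.+1 v.
Hypothesis Ky' : forall l m v, K m v -> K m.+1 (y' l v).
Hypothesis HS : forall m v, H m v -> H m.+1 v.
Hypothesis Hy : forall l m v, H m v -> H m.+1 (y l v).
Variables (I0 : finType) (p0 : I0 -> V -> V).
Hypothesis p0L : forall i, linop (p0 i).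
Hypothesis p0C : forall i l v, y' l (p0 i v) = p0 i (y' l v).
Hypothesis p0H : forall i m v, K m v -> H (m + c) (p0 i v).
Hypothesis p0free : forall a : I0 -> k,
  (forall v, K 0 v -> \sum_i a i *: p0 i v = 0) -> forall i, a i = 0.

(** The operators are monomials in the first [l] generators, with exponents at most [s], composed
    with some [p0 i]. Independence is proved by stripping one generator at a time with
    [kill_coefficients], at the price of [s] letters each; the coefficients met there commute with
    the dual because it belongs to a later generator. *)
Lemma monomial_family l : (l <= N)%N ->
  exists (I : finType) (p : I -> V -> V),
  [/\ #|I| = (s.+1 ^ l * #|I0|)%N,
      forall i, linop (p i),
      forall i (j : 'I_N) v, (l <= j)%N -> y' j (p i v) = p i (y' j v),
      forall i m v, K m v -> H (m + c + l * s) (p i v) &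
      forall a : I -> k, (forall v, K (l * s) v -> \sum_i a i *: p i v = 0) ->
        forall i, a i = 0].
Proof.
elim: l => [_|l IH lN].
  by exists I0, p0; rewrite mul1n; split=> // i m v /p0H; rewrite addn0.
have [I [p [cI pL pC pH pfree]]] := IH (ltnW lN).
pose o := Ordinal lN.
exists ('I_s.+1 * I)%type, (fun (ei : 'I_s.+1 * I) v => iter ei.1 (y o) (p ei.2 v)); split.
- by rewrite card_prod card_ord cI expnS mulnA.
- by move=> [e i]; apply: linop_comp => //; apply: linop_iter.
- move=> [e i] j v lj /=; rewrite -pC ?(ltnW lj) //.
  by elim: (e : nat) => [|e' IHe] //=; rewrite y'C ?IHe.
- move=> [[e es] i] m v Kv /=; have {Kv} := pH i m v Kv.
  rewrite mulSn addnCA; have {es} : (e <= s)%N by [].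
  move: (m + c + l * s)%N (p i v) => q w.
  elim: s e => [|s' IHs] [|e] //= es Hv; rewrite addSn.
  + by apply: HS; apply: (IHs 0%N).
  + by apply: Hy; apply: IHs.
move=> a aK [e i]; move: i; apply: pfree => v Kv.
(* [z e] is the coefficient of the power e of the new generator; [inord] extends it to all naturals,
   and only e <= s matters. *)
pose z e v := \sum_i a (inord e, i) *: p i v.
have -> : \sum_i a (e, i) *: p i v = z e v.
  by apply: eq_bigr => i _; rewrite inord_val.
apply: (@kill_coefficients (y o) (y' o) (kap o) K _ _ _ _ _ _ s (l * s)) => //.
- by move=> ? ?; apply: Ky'.
- move=> e' w; rewrite (linop_comb (y'L o)); apply: eq_bigr => i _.
  by rewrite pC.
- move=> w Kw; rewrite -mulSn in Kw.
  apply: etrans (aK w Kw).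
  transitivity (\sum_(e' < s.+1) \sum_i a (e', i) *: iter e' (y o) (p i w)).
    apply: eq_bigr => e' _; rewrite (linop_comb (linop_iter _ (yL o))).
    by apply: eq_bigr => i _; rewrite inord_val.
  by rewrite pair_bigA; apply: eq_bigr => -[].
- by rewrite -ltnS.
Qed.
End Family.
End Bernstein.

(** * The operators of L_+ *)

Lemma sum_delta (k : fieldType) (V : lmodType k) (I : finType) (j : I) (F : I -> V) :
  \sum_l (l == j)%:R *: F l = F j.
Proof.
rewrite (bigD1 j) //= eqxx scale1r big1 ?addr0 // => l /negPf ->.
by rewrite scale0r.
Qed.

Section Operators.
Variables (k : fieldType) (n : nat) (M : AVmod k n).
Local Notation MT := (AVcar M).
Local Notation A := {mpoly k[n]}.
Implicit Types (f g : A) (u v : MT) (i j l p : 'I_n) (eta : Vder k n).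

(* In D (x) U(L_+), the operator [psi f p] is the sum over m <> 0 of
   (d^m f / m!) (x) X^m d/dX_p, [glop i j] is 1 (x) X_i d/dX_j, and [theta f p]
   keeps the terms with |m| >= 2 of [psi f p]. *)
Definition vf f p : Vder k n := [ffun j => if j == p then f else 0].
Definition pder p u : MT := actV M (vf 1 p) u.
Definition psi f p u : MT := actV M (vf f p) u - actA M f (pder p u).
Definition glop i j u : MT := psi 'X_i j u.
Definition theta f p u : MT :=
  psi f p u - \sum_l actA M (mderiv l f) (glop l p u).

Lemma actA_linop f : linop (actA M f). Proof. by move=> a u v; exact: actA_linr. Qed.
Lemma actA_linopl u : linop (fun f : A => actA M f u).
Proof. by move=> a f g; exact: actA_linl. Qed.
Lemma actV_linop eta : linop (actV M eta). Proof. by move=> a u v; exact: actV_linr. Qed.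
Lemma actV_linopl u : linop (fun eta : Vder k n => actV M eta u).
Proof. by move=> a eta xi; exact: actV_linl. Qed.

Lemma actAC f g u : actA M f (actA M g u) = actA M g (actA M f u).
Proof. by rewrite -!actAM mulrC. Qed.

Lemma vf_linop p : linop (fun f : A => vf f p).
Proof.
by move=> a f g; apply/ffunP => j; rewrite !ffunE; case: ifP; rewrite ?scaler0 ?addr0.
Qed.

Lemma vf_sum eta : eta = \sum_p vf (eta p) p.
Proof.
apply/ffunP => j; rewrite sum_ffunE (bigD1 j) //= ffunE eqxx big1 ?addr0 // => p pj.
by rewrite ffunE eq_sym (negPf pj).
Qed.

Lemma der_vf f p g : der (vf f p) g = f * mderiv p g.
Proof.
rewrite /der (bigD1 p) //= ffunE eqxx big1 ?addr0 // => i ip.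
by rewrite ffunE (negPf ip) mul0r.
Qed.

Lemma lieV_vf f p g q :
  lieV (vf f p) (vf g q) = vf (f * mderiv p g) q - vf (g * mderiv q f) p.
Proof.
apply/ffunP => j; rewrite !ffunE !der_vf.
by do 2!case: ifP => _; rewrite ?mderiv0 ?mulr0.
Qed.

Lemma mderiv_linop p : linop (mderiv p : A -> A).
Proof. by move=> a f g; rewrite mderivD mderivZ. Qed.

Lemma mderivXi i p : mderiv p ('X_i : A) = (p == i)%:R.
Proof.
rewrite mderivX mnm1E eq_sym; case: eqP => [->|_]; last by rewrite scale0r.
by rewrite -{1}[U_(i)%MM]addm0 addmC addmK mpolyX0 scale1r.
Qed.

Lemma mderiv1 p : mderiv p (1 : A) = 0.
Proof. by rewrite -mpolyC1 mderivC. Qed.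

Lemma pder_linop p : linop (pder p). Proof. exact: actV_linop. Qed.
Lemma psi_linop f p : linop (psi f p).
Proof.
move=> a u v; rewrite /psi actV_linr (pder_linop p) (actA_linop f).
rewrite scalerBr. zmodule.
Qed.
Lemma psi_linopl p u : linop (fun f : A => psi f p u).
Proof.
move=> a f g; rewrite /psi (vf_linop p) actV_linl actA_linl scalerBr; zmodule.
Qed.
Lemma glop_linop i j : linop (glop i j). Proof. exact: psi_linop. Qed.

Lemma psi1 p u : psi 1 p u = 0.
Proof. by rewrite /psi actA1 subrr. Qed.

Lemma pderA j f u : pder j (actA M f u) = actA M (mderiv j f) u + actA M f (pder j u).
Proof. by rewrite /pder actAV der_vf mul1r. Qed.

(** Both terms of [psi] produce the same derivative f dg/dx_p, which cancels. *)
Lemma psiA f p g u : psi f p (actA M g u) = actA M g (psi f p u).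
Proof.
rewrite /psi pderA actAV der_vf (linopB (actA_linop g)) (linopD (actA_linop f)).
by rewrite -!actAM [g * f]mulrC; zmodule.
Qed.

Lemma pderC i j u : pder i (pder j u) = pder j (pder i u).
Proof.
apply/eqP; rewrite -subr_eq0 -actV_lie lieV_vf !mderiv1 !mulr0.
by rewrite !(linop0 (vf_linop _)) subrr (linop0 (actV_linopl u)).
Qed.

Lemma pder_actV j f p u :
  pder j (actV M (vf f p) u) = actV M (vf f p) (pder j u) + actV M (vf (mderiv j f) p) u.
Proof.
apply/eqP; rewrite addrC -subr_eq -actV_lie lieV_vf mderiv1 mulr0 mul1r.
by rewrite (linop0 (vf_linop _)) subr0.
Qed.

(** The factors from L_+ commute with d/dx_j, so the bracket only differentiates the Taylor
    coefficients of [f]. *)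
Lemma pder_psi j f p u : pder j (psi f p u) = psi f p (pder j u) + psi (mderiv j f) p u.
Proof.
rewrite /psi (linopB (pder_linop j)) pder_actV pderA pderC; zmodule.
Qed.

Lemma glopA i j f u : glop i j (actA M f u) = actA M f (glop i j u).
Proof. exact: psiA. Qed.

Lemma psi_delta (b : bool) p u : psi b%:R p u = 0.
Proof. by case: b; rewrite ?psi1 // (linop0 (psi_linopl _ _)). Qed.

Lemma pder_glop l i j u : pder l (glop i j u) = glop i j (pder l u).
Proof. by rewrite pder_psi mderivXi psi_delta addr0. Qed.

(** With [psi f p] read as (f(x+X) - f(x)) d/dX_p and g = df/dx_j, the bracket with X_i d/dX_j is
    X_i g(x+X) d/dX_p, minus [psi f j] when p = i. The two middle terms come from X_i g(x+X) = (x_i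
    + X_i) g(x+X) - x_i g(x+X). *)
Lemma glop_psi i j f p u :
  glop i j (psi f p u) = psi f p (glop i j u) + psi ('X_i * mderiv j f) p u
    - actA M 'X_i (psi (mderiv j f) p u) - (p == i)%:R *: psi f j u.
Proof.
have fpi : f * (p == i)%:R = ((p == i)%:R : k) *: f.
  by case: eqP => _; rewrite ?mulr1 ?mulr0 ?scale1r ?scale0r.
have E : actV M (vf 'X_i j) (actV M (vf f p) u) = actV M (vf f p) (actV M (vf 'X_i j) u) 
   + actV M (vf ('X_i * mderiv j f) p) u - (p == i)%:R *: actV M (vf f j) u.
  have := actV_lie (vf 'X_i j) (vf f p) u; rewrite lieV_vf mderivXi.
  rewrite (linopB (actV_linopl u)).
  rewrite fpi (linopZ (vf_linop j)) (linopZ (actV_linopl u)) => E.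
  move/eqP: E; rewrite eq_sym subr_eq => /eqP ->; zmodule.
have F : glop i j (actA M f (pder p u)) = actA M f (pder p (glop i j u)).
  by rewrite glopA pder_glop.
rewrite {1}/psi (linopB (glop_linop i j)) F {1}/glop {1}/psi E.

have -> : psi f p (glop i j u) = actV M (vf f p) (actV M (vf 'X_i j) u)
   - ((p == i)%:R *: actA M f (pder j u) + actA M 'X_i (actV M (vf f p) (pder j u)))
   - actA M f (pder p (glop i j u)).
  rewrite {1}/psi {1}/glop /psi (linopB (actV_linop _)) actAV der_vf mderivXi fpi.
  by rewrite (linopZ (actA_linopl _)).
rewrite pder_actV /psi (linopB (actA_linop 'X_i)) actAM (linopD (actA_linop 'X_i)).
rewrite scalerBr; zmodule.
Qed.

Lemma theta_linop f p : linop (theta f p).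
Proof.
move=> a u v; rewrite /theta psi_linop [a *: (_ - \sum__ _)]scalerBr.
under eq_bigr => l _ do rewrite glop_linop actA_linop.
by rewrite big_split /= -scaler_sumr; zmodule.
Qed.

Lemma theta_linopl p u : linop (fun f : A => theta f p u).
Proof.
move=> a f g; rewrite /theta (psi_linopl p u) [a *: (_ - \sum__ _)]scalerBr.
under eq_bigr => l _ do rewrite (mderiv_linop l) actA_linl.
by rewrite big_split /= -scaler_sumr; zmodule.
Qed.

Lemma thetaA f p g u : theta f p (actA M g u) = actA M g (theta f p u).
Proof.
rewrite /theta psiA (linopB (actA_linop g)) (linop_sum (actA_linop g)).
by congr (_ - _); apply: eq_bigr => l _; rewrite glopA actAC.
Qed.

Lemma pder_theta j f p u :
  pder j (theta f p u) = theta f p (pder j u) + theta (mderiv j f) p u.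
Proof.
rewrite /theta (linopB (pder_linop j)) (linop_sum (pder_linop j)) pder_psi.
under eq_bigr => l _ do rewrite pderA pder_glop mderiv_comm.
rewrite big_split /=; zmodule.
Qed.

Lemma glopC i j l p u :
  glop i j (glop l p u) = glop l p (glop i j u)
    + (l == j)%:R *: glop i p u - (p == i)%:R *: glop l j u.
Proof.
apply: etrans (glop_psi i j 'X_l p u) _.
rewrite mderivXi eq_sym psi_delta (linop0 (actA_linop _)) subr0.
congr (_ + _ - _); case: eqP => _; rewrite ?mulr1 ?scale1r //.
by rewrite mulr0 scale0r (linop0 (psi_linopl _ _)).
Qed.

(** The formula of [glop_psi] survives the removal of the degree one terms because brackets with L_0
    preserve the degree in X. *)
Lemma glop_theta i j f p u :
  glop i j (theta f p u) = theta f p (glop i j u) + theta ('X_i * mderiv j f) p u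
    - actA M 'X_i (theta (mderiv j f) p u) - (p == i)%:R *: theta f j u.
Proof.
rewrite /theta (linopB (glop_linop i j)) (linop_sum (glop_linop i j)) glop_psi.
rewrite (linopB (actA_linop 'X_i)) (linop_sum (actA_linop 'X_i)).
under [\sum_l glop i j _]eq_bigr => l _.
  rewrite glopA glopC (linopB (actA_linop _)) (linopD (actA_linop _)).
  rewrite !(linopZ (actA_linop _)); over.
under [\sum_l actA M _^`M(l) (glop l p u)]eq_bigr => l _.
  rewrite mderivM mderivXi (linopD (actA_linopl _)) actAM; over.
rewrite !big_split /= !sumrN scalerBr scaler_sumr.
rewrite -!scaler_sumr (sum_delta j (fun l => actA M (mderiv l f) (glop i p u))).
have -> : \sum_l actA M ((l == i)%:R * mderiv j f) (glop l p u) =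
    actA M (mderiv j f) (glop i p u).
  rewrite -[RHS](sum_delta i (fun l => actA M (mderiv j f) (glop l p u))).
  apply: eq_bigr => l _; case: eqP => _; rewrite ?mul1r ?scale1r //.
  by rewrite mul0r scale0r (linop0 (actA_linopl _)).
zmodule.
Qed.

(* The vector field [f d/dx_p] acts as [f d/dx_p] in the Weyl algebra, plus the
   first order Taylor terms of [f], plus the remainder [theta]. *)
Lemma actVE eta u : actV M eta u =
  \sum_p (actA M (eta p) (pder p u) +
          \sum_l actA M (mderiv l (eta p)) (glop l p u) + theta (eta p) p u).
Proof.
rewrite {1}[eta]vf_sum (linop_sum (actV_linopl u)); apply: eq_bigr => p _.
rewrite /theta /psi; zmodule.
Qed.

Lemma submodule_of_stable (N : MT -> Prop) : subspace N ->
  (forall f u, N u -> N (actA M f u)) ->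
  (forall p u, N u -> N (pder p u)) ->
  (forall i j u, N u -> N (glop i j u)) ->
  (forall f p u, N u -> N (theta f p u)) -> submodule N.
Proof.
move=> NS NA Nd Ng Nt; split=> //; [exact: NS.1 | exact: NS.2|].
move=> eta u Nu; rewrite actVE; apply: subspace_sum => // p _.
apply: subspaceD => //; last exact: Nt.
apply: subspaceD => //; first by apply/NA/Nd.
by apply: subspace_sum => // l _; apply/NA/Ng.
Qed.

Lemma theta_mpolyC_X (c : k) p u : theta c%:MP p u = 0.
Proof.
rewrite /theta big1 ?subr0 => [|l _]; last first.
  by rewrite mderivC (linop0 (actA_linopl _)).
by rewrite -alg_mpolyC (linopZ (psi_linopl _ _)) psi1 scaler0.
Qed.

Lemma theta_X i p u : theta 'X_i p u = 0.
Proof.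
rewrite /theta (eq_bigr (fun l => (l == i)%:R *: glop l p u)) => [|l _].
  by rewrite (sum_delta i (fun l => glop l p u)) subrr.
rewrite mderivXi; case: eqP => _; first by rewrite actA1 scale1r.
by rewrite (linop0 (actA_linopl _)) scale0r.
Qed.
End Operators.

(** * Growth of AV-modules *)

Section Words.
Variables (k : fieldType) (n : nat) (M : AVmod k n).
Local Notation MT := (AVcar M).
Implicit Types (u v x : MT) (fs : seq (Apoly k n)) (etas : seq (Vder k n)).

Lemma dimspan_mono (s t : seq MT) : {subset s <= t} -> (dimspan s <= dimspan t)%N.
Proof.
move=> st; have [b [<- bfree bs _]] := dimspan_basis s.
rewrite -[size b]card_ord; apply: indep_le_dimspan bfree _ => i.
by apply/mem_inspan/st/bs; rewrite mem_nth.
Qed.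

Lemma words_mono (ops : seq (MT -> MT)) (M0 : seq MT) m m' : (m <= m')%N ->
  {subset words ops M0 m <= words ops M0 m'}.
Proof.
move=> /subnK <-; elim: (m' - m)%N => [|e IH] // x /IH.
by rewrite /= mem_cat => ->.
Qed.

Lemma mem_wordsS (I : eqType) (op : I -> MT -> MT) (r : seq I) (M0 : seq MT) m x :
  reflect (x \in words (map op r) M0 m \/
           exists i v, [/\ i \in r, v \in words (map op r) M0 m & x = op i v])
    (x \in words (map op r) M0 m.+1).
Proof.
rewrite /= mem_cat allpairs_mapl; apply: (iffP orP) => -[].
- by left.
- by move=> /allpairsP[[i v] /= [ir vw ->]]; right; exists i, v.
- by left.
- by move=> [i [v [ir vw ->]]]; right; apply/allpairsP; exists (i, v).
Qed.

(** A single index type for both actions, so that [mem_wordsS] applies to mixed words. *)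
Definition AVop (e : Apoly k n + Vder k n) : MT -> MT :=
  match e with inl f => actA M f | inr eta => actV M eta end.

Lemma opsofE fs etas :
  @opsof k n M fs etas = map AVop ([seq inl f | f <- fs] ++ [seq inr eta | eta <- etas]).
Proof. by rewrite map_cat -!map_comp. Qed.

Lemma words_actA fs etas (M0 : seq MT) m f v : f \in fs ->
  v \in words (opsof M fs etas) M0 m -> actA M f v \in words (opsof M fs etas) M0 m.+1.
Proof.
rewrite opsofE => ffs vw; apply/mem_wordsS; right; exists (inl f), v; split=> //.
by rewrite mem_cat map_f.
Qed.

Lemma words_actV fs etas (M0 : seq MT) m eta v : eta \in etas ->
  v \in words (opsof M fs etas) M0 m -> actV M eta v \in words (opsof M fs etas) M0 m.+1.
Proof.
rewrite opsofE => ffs vw; apply/mem_wordsS; right; exists (inr eta), v; split=> //.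
by rewrite mem_cat map_f ?orbT.
Qed.

Lemma words_ind fs etas (M0 : seq MT) (N : nat -> MT -> Prop) :
  (forall v, v \in M0 -> N 0%N v) ->
  (forall m v, N m v -> N m.+1 v) ->
  (forall m f v, f \in fs -> N m v -> N m.+1 (actA M f v)) ->
  (forall m eta v, eta \in etas -> N m v -> N m.+1 (actV M eta v)) ->
  forall m v, v \in words (opsof M fs etas) M0 m -> N m v.
Proof.
move=> N0 NS NA NV; elim=> [|m IH] v; first exact: N0.
rewrite opsofE => /mem_wordsS; rewrite -opsofE => -[/IH/NS //|[e [w [er /IH Nw ->]]]].
move: er; rewrite mem_cat => /orP[] /mapP[x xr ->]; [exact: NA | exact: NV].
Qed.

Lemma words_sub fs etas etas' (M0 : seq MT) m : {subset etas <= etas'} ->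
  {subset words (opsof M fs etas) M0 m <= words (opsof M fs etas') M0 m}.
Proof.
move=> ss v; move: m v.
apply: (@words_ind _ _ _ (fun m v => v \in words (opsof M fs etas') M0 m)) => //.
- by move=> m v; apply: (words_mono (leqnSn m)).
- by move=> m f v; apply: words_actA.
- by move=> m eta v /ss; apply: words_actV.
Qed.

Lemma inspan_words_mono (ops : seq (MT -> MT)) (M0 : seq MT) m m' v : (m <= m')%N ->
  inspan (words ops M0 m) v -> inspan (words ops M0 m') v.
Proof.
move=> mm'; apply: inspan_trans => x xw; apply: mem_inspan.
exact: words_mono xw.
Qed.

Lemma inspan_words_actA fs etas (M0 : seq MT) m f v : f \in fs ->
  inspan (words (opsof M fs etas) M0 m) v ->
  inspan (words (opsof M fs etas) M0 m.+1) (actA M f v).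
Proof.
move=> ffs.
apply: (@inspan_min _ _ (fun v => inspan (words (opsof M fs etas) M0 m.+1) (actA M f v))).
  exact: subspace_preim (actA_linop f) (inspan_subspace _).
by move=> x xw; apply/mem_inspan/words_actA.
Qed.

Lemma inspan_words_actV fs etas (M0 : seq MT) m eta v : eta \in etas ->
  inspan (words (opsof M fs etas) M0 m) v ->
  inspan (words (opsof M fs etas) M0 m.+1) (actV M eta v).
Proof.
move=> etas_eta.
apply: (@inspan_min _ _ (fun v => inspan (words (opsof M fs etas) M0 m.+1) (actV M eta v))).
  exact: subspace_preim (actV_linop eta) (inspan_subspace _).
by move=> x xw; apply/mem_inspan/words_actV.
Qed.
End Words.

Section BernsteinInequality.
Variables (k : fieldType) (n : nat).
Hypothesis char0 : [pchar k] =i pred0.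

Definition coords : seq (Apoly k n) := [seq 'X_i | i <- enum 'I_n].
Definition partials : seq (Vder k n) := [seq vf 1 i | i <- enum 'I_n].
(** The fields x_i d/dx_j are adjoined so that [glop i j] is a difference of a word of length one
    and a word of length two. *)
Definition linear_fields : seq (Vder k n) :=
  partials ++ [seq vf 'X_ij.1 ij.2 | ij : 'I_n * 'I_n].

Lemma mem_coords i : 'X_i \in coords.
Proof. by apply: map_f; rewrite mem_enum. Qed.

Lemma mem_partials i : vf 1 i \in partials.
Proof. by apply: map_f; rewrite mem_enum. Qed.

Lemma partials_sub : {subset partials <= linear_fields}.
Proof. by move=> eta; rewrite mem_cat => ->. Qed.

Lemma mem_linear_fields i j : vf 'X_i j \in linear_fields.
Proof.
by rewrite mem_cat; apply/orP; right; apply/mapP; exists (i, j); rewrite ?mem_enum.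
Qed.

Variable M : AVmod k n.
Local Notation MT := (AVcar M).
Implicit Types (u v : MT).

(** Each generator is paired with a dual whose commutator with it is the scalar [weyl_sign], so
    bracketing with the dual is differentiation in that generator. *)
Definition weyl_gen (l : 'I_(n + n)) : MT -> MT :=
  match split l with inl i => actA M 'X_i | inr i => pder i end.
Definition weyl_dual (l : 'I_(n + n)) : MT -> MT :=
  match split l with inl i => pder i | inr i => actA M 'X_i end.
Definition weyl_sign (l : 'I_(n + n)) : k :=
  match split l with inl i => 1 | inr i => -1 end.

Lemma pderX i j u :
  pder i (actA M 'X_j u) = actA M 'X_j (pder i u) + (i == j)%:R *: u.
Proof.
rewrite pderA mderivXi addrC; congr (_ + _).
by case: eqP => _; rewrite ?actA1 ?scale1r // scale0r (linop0 (actA_linopl u)).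
Qed.

Lemma weyl_dualC (l j : 'I_(n + n)) u : (l < j)%N ->
  weyl_dual j (weyl_gen l u) = weyl_gen l (weyl_dual j u).
Proof.
rewrite /weyl_dual /weyl_gen.
case: (splitP l) => i li; case: (splitP j) => i' ji' /=; rewrite li ji' => lj.
- by rewrite pderX -val_eqE gtn_eqF // scale0r addr0.
- by rewrite actAC.
- by have := leq_ltn_trans (leq_addr i n) lj; rewrite ltnNge ltnW.
- by rewrite pderX -val_eqE ltn_eqF ?scale0r ?addr0 // -(ltn_add2l n).
Qed.

(* Bernstein's inequality: a nonzero operator of the Weyl algebra of order at
   most [2 n s] cannot kill all words of length at most [2 n s] applied to [u];
   the extra operators [w] commute with the Weyl algebra. *)
Lemma bernstein_inequality etas u c (I0 : finType) (w : I0 -> MT -> MT) s :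
  {subset partials <= etas} ->
  (forall i, linop (w i)) ->
  (forall i j v, w i (actA M 'X_j v) = actA M 'X_j (w i v)) ->
  (forall i j v, w i (pder j v) = pder j (w i v)) ->
  (forall i m v, v \in words (opsof M coords partials) [:: u] m ->
     inspan (words (opsof M coords etas) [:: u] (m + c)) (w i v)) ->
  indep (fun i => w i u) ->
  (s.+1 ^ (n + n) * #|I0| <=
     dimspan (words (opsof M coords etas) [:: u] ((n + n) * s + c + (n + n) * s)) ^ 2)%N.
Proof.
move=> detas wL wX wd wH wfree.
pose K m v := v \in words (opsof M coords partials) [:: u] m.
pose H m v := inspan (words (opsof M coords etas) [:: u] m) v.
have [] := @monomial_family k char0 MT (n + n) s weyl_gen weyl_dual weyl_sign K H c
  _ _ _ _ _ _ _ _ _ I0 w _ _ _ _ (n + n) (leqnn _).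
- by move=> l; rewrite /weyl_gen; case: (split l) => i; [apply: actA_linop | apply: pder_linop].
- by move=> l; rewrite /weyl_dual; case: (split l) => i; [apply: pder_linop | apply: actA_linop].
- by move=> l; rewrite /weyl_sign; case: (split l) => i; rewrite ?oppr_eq0 oner_eq0.
- move=> l v; rewrite /weyl_dual /weyl_gen /weyl_sign; case: (split l) => i.
    by rewrite pderX eqxx.
  by rewrite pderX eqxx scaleN1r scale1r addrK.
- exact: weyl_dualC.
- by move=> m v; apply: (words_mono (leqnSn m)).
- move=> l m v Kv; rewrite /weyl_dual; case: (split l) => i.
    by apply: words_actV => //; apply: mem_partials.
  by apply: words_actA => //; apply: mem_coords.
- by move=> m v; apply: (inspan_words_mono (leqnSn m)).
- move=> l m v Hv; rewrite /weyl_gen; case: (split l) => i.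
    by apply: inspan_words_actA => //; apply: mem_coords.
  by apply: inspan_words_actV => //; apply/detas/mem_partials.
- exact: wL.
- by move=> i l v; rewrite /weyl_dual; case: (split l) => j; rewrite ?wX ?wd.
- exact: wH.
- by move=> a Ha; apply: wfree; apply: Ha; rewrite /K /= mem_head.
move=> I [p [<- pL _ pH pfree]].
have [B [sB _ Bs sB']] := dimspan_basis (words (opsof M coords partials) [:: u] ((n + n) * s)).
have [C [sC _ _ sC']] :=
  dimspan_basis (words (opsof M coords etas) [:: u] ((n + n) * s + c + (n + n) * s)).
(* The family is independent as maps from the span of [B] to the span of [C]; since [B] is no larger
   than [C], the product is at most a square. *)
apply: (@leq_trans (size B * size C)).
  apply: (@indep_ops_card _ _ _ p) => [i x xB|a aB].
    by apply: inspan_trans sC' _; apply: pH; apply: Bs.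
  apply: pfree => v /sB'; apply: (linop_eq_on_span (f := fun v => \sum_i a i *: p i v)) => //.
  by apply: linop_sum_op => i; apply: linopZ_op.
rewrite -mulnn sB sC leq_mul2r; apply/orP; right.
apply: dimspan_mono => v /(words_sub detas); apply: words_mono.
by rewrite -addnA leq_addr.
Qed.
End BernsteinInequality.

(** * Local finiteness of the action of gl_n *)

Section GlFinite.
Variables (k : fieldType) (n : nat).
Hypothesis char0 : [pchar k] =i pred0.
Variable M : AVmod k n.
Local Notation MT := (AVcar M).
Implicit Types (u v : MT).

Lemma expn_pow (a e : nat) : (a ^ e)%N = Nat.pow a e.
Proof. by elim: e => //= e <-; rewrite expnS. Qed.

Lemma gk_exponent_le fs etas (M0 : seq MT) :
  Rbar.Rbar_le (gk_exponent fs etas M0) (GKdim M).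
Proof.
rewrite /GKdim; set E := fun x => _; rewrite /Lub.Rbar_lub.
by case: (Lub.Rbar_ex_lub E) => l [ub _] /=; apply: ub; exists fs, etas, M0.
Qed.

Definition gl_stable (d : nat) (w : 'I_d -> MT) :=
  forall i j b, exists c : 'I_d -> k, glop i j (w b) = \sum_a c a *: w a.

Definition gl_words u m : seq MT :=
  words [seq glop ij.1 ij.2 | ij : 'I_n * 'I_n] [:: u] m.

(** Bernstein's argument needs operators rather than vectors, so a word in gl_n is lifted to an
    operator commuting with the Weyl algebra and taking [u] to that word. *)
Lemma gl_words_op u m v : v \in gl_words u m ->
  exists w : MT -> MT, [/\ linop w,
    forall j x, w (actA M 'X_j x) = actA M 'X_j (w x),
    forall j x, w (pder j x) = pder j (w x),
    forall a x, inspan (words (opsof M (coords k n) (linear_fields k n)) [:: u] a) x ->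
      inspan (words (opsof M (coords k n) (linear_fields k n)) [:: u] (a + m.*2)) (w x) &
    w u = v].
Proof.
elim: m v => [|m IH] v.
  by rewrite inE => /eqP ->; exists id; split=> // a x; rewrite addn0.
move=> /mem_wordsS[/IH[w [wL wX wd wH wu]]|[[i j] [v' [_ /IH[w [wL wX wd wH wu]] ->]]]].
  exists w; split=> // a x /wH; apply: inspan_words_mono.
  by rewrite leq_add2l leq_double.
exists (fun x => glop i j (w x)); split=> [|l x|l x|a x /wH Hx|] /=.
- exact: linop_comp (glop_linop i j) wL.
- by rewrite wX glopA.
- by rewrite wd pder_glop.
- rewrite doubleS !addnS.
  apply: subspaceB; first exact: inspan_subspace.
    apply: inspan_words_mono (leqnSn _) _.
    by apply: inspan_words_actV => //; apply: mem_linear_fields.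
  apply: inspan_words_actA; first exact: mem_coords.
  by apply: inspan_words_actV => //; apply/partials_sub/mem_partials.
- by rewrite wu.
Qed.

Lemma gl_words_bound u s :
  (s.+1 ^ (n + n) * dimspan (gl_words u s) <= dimspan
    (words (opsof M (coords k n) (linear_fields k n)) [:: u] ((2 * (n + n) + 2) * s)) ^ 2)%N.
Proof.
have [b [<- bfree bs _]] := dimspan_basis (gl_words u s).
have /fin_all_exists[w wP] (i : 'I_(size b)) := gl_words_op (bs _ (mem_nth 0 (ltn_ord i))).
rewrite -[size b]card_ord.
(* The lengths are 2ns for the test words, 2s for the words in gl_n (two letters per [glop]) and 2ns
   for the Weyl monomials. *)
have -> : ((2 * (n + n) + 2) * s = (n + n) * s + s.*2 + (n + n) * s)%N.
  by rewrite mulnDl -mulnA mul2n -addnn mul2n addnAC.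
apply: (bernstein_inequality char0 (w := w)); try by move=> i; case: (wP i).
- exact: partials_sub.
- move=> i m v vw; have [_ _ _ wH _] := wP i; apply/wH/mem_inspan.
  by apply: words_sub vw; apply: partials_sub.
by move=> c; under eq_bigr => i _ do have [_ _ _ _ ->] := wP i; apply: bfree.
Qed.

Lemma gl_words_stabilize u : u != 0 ->
  Rbar.Rbar_le (GKdim M) (Rbar.Finite (Raxioms.INR n)) ->
  exists m, forall v, v \in gl_words u m.+1 -> inspan (gl_words u m) v.
Proof.
move=> u0 GK; apply/asbP/negPn/negP => /asbP nstab.
have grow s : (s < dimspan (gl_words u s))%N.
  elim: s => [|s IH].
    rewrite -[1%N]card_ord; apply: (@indep_le_dimspan _ _ _ _ (fun _ : 'I_1 => u)).
      move=> c; rewrite big_ord1 => /eqP; rewrite scaler_eq0 (negPf u0) orbF.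
      by move=> /eqP c0 i; rewrite [i]ord1.
    by move=> _; apply: mem_inspan; rewrite mem_head.
  apply: leq_ltn_trans IH _.
  have [b [<- bfree bs sb]] := dimspan_basis (gl_words u s).
  have [v [vw nv]] : exists v, v \in gl_words u s.+1 /\ ~ inspan (gl_words u s) v.
    apply/asbP/negPn/negP => /asbP H; case: nstab; exists s => v vw.
    by apply/asbP/negPn/negP => /asbP H'; case: H; exists v.
  have vb : ~ inspan b v.
    by move=> vb; apply: nv; apply: inspan_trans vb => x /bs; apply: mem_inspan.
  have := indep_le_dimspan (s := gl_words u s.+1) (indep_cons vb bfree).
  rewrite card_ord; apply=> i; apply: mem_inspan.
  have := mem_nth 0 (ltn_ord i); rewrite inE => /predU1P[->//|/bs].
  exact: (words_mono (leqnSn s)).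
set D := fun m => dimspan (words (opsof M (coords k n) (linear_fields k n)) [:: u] m).
(* By [grow], the second factor in [gl_words_bound] supplies one more power of s+1. *)
have HD s : Peano.le (Nat.pow s.+1 (n + n).+1)%N (Nat.pow (D (Nat.mul (2 * (n + n) + 2)%N s)) 2).
  rewrite -!expn_pow; apply/leP; apply: leq_trans (gl_words_bound u s).
  by rewrite expnSr leq_mul2l grow orbT.
have q2 : Peano.le 2 (2 * (n + n) + 2)%N by apply/leP; rewrite leq_addl.
have H := Growth.half_power_le_growth _ _ _ q2 HD.
have := Rbar.Rbar_le_trans _ _ _ H (Rbar.Rbar_le_trans _ _ _
  (gk_exponent_le (coords k n) (linear_fields k n) [:: u]) GK).
rewrite /Rbar.Rbar_le RIneq.S_INR RIneq.plus_INR.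
by Lra.lra.
Qed.

Lemma gl_finite u : u != 0 -> Rbar.Rbar_le (GKdim M) (Rbar.Finite (Raxioms.INR n)) ->
  exists (d : nat) (w : 'I_d -> MT), [/\ (0 < d)%N, indep w & gl_stable w].
Proof.
move=> u0 /(gl_words_stabilize u0)[m stab].
have [b [_ bfree bs sb]] := dimspan_basis (gl_words u m).
exists (size b), (fun i => b`_i); split=> //.
  rewrite lt0n; apply/negP => /eqP/size0nil b0.
  have := sb u (words_mono (leq0n m) (mem_head u [::])).
  by rewrite b0 => -[c]; rewrite big_ord0 => /eqP; rewrite (negPf u0).
(* The basis vectors are themselves words of length at most [m], so [glop] turns them into words of
   length [m.+1], to which [stab] applies. *)
move=> i j a; apply: (inspan_trans sb); apply: stab; apply/mem_wordsS; right.
exists (i, j), b`_a; split=> //; first by rewrite mem_enum.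
by apply/bs/mem_nth.
Qed.
End GlFinite.

(** * Vanishing of the higher order part *)

Lemma exists_eigenvector (k : closedFieldType) d (C : 'M[k]_d) : (0 < d)%N ->
  exists (lam : k) (x : 'rV_d), x != 0 /\ x *m C = lam *: x.
Proof.
move=> d0; have /closed_rootP[lam] : size (char_poly C) != 1%N.
  by rewrite size_char_poly eqSS -lt0n.
by rewrite -eigenvalue_root_char => /eigenvalueP[x xC x0]; exists lam, x.
Qed.

Section Euler.
Variables (k : fieldType) (n : nat) (M : AVmod k n).
Local Notation MT := (AVcar M).
Implicit Types (u v : MT) (i j l p : 'I_n) (m : 'X_{1..n}).

Definition euler u : MT := \sum_i glop i i u.

Lemma euler_linop : linop euler.
Proof. by apply: linop_sum_op => i; apply: glop_linop. Qed.

Lemma eulerA f u : euler (actA M f u) = actA M f (euler u).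
Proof.
by rewrite /euler (linop_sum (actA_linop f)); apply: eq_bigr => i _; rewrite glopA.
Qed.

Lemma euler_pder j u : euler (pder j u) = pder j (euler u).
Proof.
by rewrite /euler (linop_sum (pder_linop j)); apply: eq_bigr => i _; rewrite pder_glop.
Qed.

Lemma euler_glop l p u : euler (glop l p u) = glop l p (euler u).
Proof.
rewrite /euler (eq_bigr _ (fun i _ => glopC i i l p u)) sumrB big_split /=.
under [\sum_i (l == i)%:R *: _]eq_bigr => i _ do rewrite eq_sym.
under [\sum_i (p == i)%:R *: _]eq_bigr => i _ do rewrite eq_sym.
rewrite (sum_delta l (fun i => glop i p u)) (sum_delta p (fun i => glop l i u)).
by rewrite addrK (linop_sum (glop_linop l p)).
Qed.

Lemma euler_monomial m :
  \sum_i 'X_i * mderiv i ('X_[m] : {mpoly k[n]}) = (mdeg m)%:R *: 'X_[m].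
Proof.
rewrite mdegE natr_sum scaler_suml; apply: eq_bigr => i _.
rewrite mderivX -scalerAr -mpolyXD; case: (posnP (m i)) => [->|mi].
  by rewrite !scale0r.
by rewrite addmC submK // lep1mP -lt0n.
Qed.

(** The top part X^m d/dX_p of [theta] has degree |m| - 1, but the lower Taylor terms have smaller
    degree. The last sum corrects for them and involves only smaller monomials, hence the inductions
    on [mdeg m] below. *)
Lemma euler_theta m p u : euler (theta 'X_[m] p u) =
  theta 'X_[m] p (euler u) + (mdeg m)%:R *: theta 'X_[m] p u
   - theta 'X_[m] p u
   - \sum_i (m i)%:R *: actA M 'X_i (theta 'X_[(m - U_(i))%MM] p u).
Proof.
rewrite /euler (eq_bigr _ (fun i _ => glop_theta i i 'X_[m] p u)) 2!sumrB big_split /=.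
rewrite -(linop_sum (theta_linop _ _)) -(linop_sum (theta_linopl p u)) euler_monomial.
rewrite (linopZ (theta_linopl p u)).
under [\sum_i (p == i)%:R *: _]eq_bigr => i _ do rewrite eq_sym.
rewrite (sum_delta p (fun i => theta 'X_[m] i u)).
under [\sum_i actA M 'X_i _]eq_bigr => i _ do
  rewrite mderivX (linopZ (theta_linopl p u)) (linopZ (actA_linop _)).
zmodule.
Qed.

Lemma natr_pred (a : nat) : (0 < a)%N -> a%:R = a.-1%:R + 1 :> k.
Proof. by move=> a0; rewrite natr1 prednK. Qed.

Variable lam : k.

(* The span of the generalised eigenspaces of [euler] for the eigenvalues
   [lam + 1], [lam + 2], and so on. *)
Inductive above : MT -> Prop :=
| above0 : above 0
| aboveS d u : above (euler u - (lam + d.+1%:R) *: u) -> above u.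

Lemma above_linop (T : MT -> MT) u : linop T ->
  (forall v, T (euler v) = euler (T v)) -> above u -> above (T u).
Proof.
move=> TL TE; elim=> [|d v _ IH]; first by rewrite (linop0 TL); apply: above0.
by apply: (@aboveS d); rewrite -TE -(linopZ TL) -(linopB TL).
Qed.

Lemma above_shift c u : above u -> above (euler u - c *: u).
Proof.
apply: (above_linop (T := fun v => euler v - c *: v)) => [a v w|v].
  by rewrite euler_linop scalerDr !scalerA [c * a]mulrC -scalerA scalerBr; zmodule.
by rewrite (linopB euler_linop) (linopZ euler_linop).
Qed.

Lemma above_subspace : subspace above.
Proof.
split=> [|a u v au av]; first exact: above0.
have {}au : above (a *: u).
  apply: (above_linop (T := fun w => a *: w)) au => [b w x|w].
    by rewrite scalerDr !scalerA mulrC.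
  by rewrite (linopZ euler_linop).
elim: au v av => [|d w _ IH] v av; first by rewrite add0r.
(* The step that shortens the derivation for [w] is applied to [v] as well; [above_shift] keeps the
   result in [above]. *)
apply: (@aboveS d); rewrite (linopD euler_linop) scalerDr opprD addrACA.
exact/IH/above_shift.
Qed.

Lemma above_theta_lower m p u :
  (forall m', (mdeg m' < mdeg m)%N -> above (theta 'X_[m'] p u)) ->
  above (\sum_i (m i)%:R *: actA M 'X_i (theta 'X_[(m - U_(i))%MM] p u)).
Proof.
move=> IH; apply: subspace_sum => [|i _]; first exact: above_subspace.
case: (posnP (m i)) => [->|mi]; first by rewrite scale0r; apply: above0.
apply: (subspaceZ _ above_subspace).
apply: (above_linop (T := actA M 'X_i)); first exact: actA_linop.
  by move=> v; rewrite eulerA.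
have im : (U_(i) <= m)%MM by rewrite lep1mP -lt0n.
by apply: IH; rewrite -{2}(submK im) mdegD mdeg1 addn1.
Qed.

Lemma theta_low_degree m p u : (mdeg m <= 1)%N -> theta 'X_[m] p u = 0.
Proof.
case E : (mdeg m) => [|[|//]] _; last first.
  by have /eqP/mdeg1P[i /eqP ->] := E; rewrite theta_X.
by move/eqP: E; rewrite mdeg_eq0 => /eqP ->; rewrite mpolyX0 -mpolyC1 theta_mpolyC_X.
Qed.

Lemma above_theta_monomial m p u : above u -> above (theta 'X_[m] p u).
Proof.
have [D] := ubnP (mdeg m); elim: D m u => // D IH m u mD au.
have [/theta_low_degree ->|m2] := leqP (mdeg m) 1; first exact: above0.
elim: u / au => [|d v av IHv]; first by rewrite (linop0 (theta_linop _ _)); apply: above0.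
have {}av : above v by apply: aboveS av.
(* [theta] raises the eigenvalue by |m| - 1 up to smaller monomials: the outer induction handles
   those, the inner one the derivation of [above]. *)
apply: (@aboveS (d + (mdeg m).-1)%N).
have -> : euler (theta 'X_[m] p v) - (lam + (d + (mdeg m).-1).+1%:R) *: theta 'X_[m] p v =
   theta 'X_[m] p (euler v - (lam + d.+1%:R) *: v) 
   - \sum_i (m i)%:R *: actA M 'X_i (theta 'X_[(m - U_(i))%MM] p v).
  rewrite euler_theta (linopB (theta_linop _ _)) (linopZ (theta_linop _ _)).
  rewrite -addSn natrD (natr_pred (ltnW m2)) addrA !scalerDl scale1r.
  zmodule.
apply: subspaceB IHv _; first exact: above_subspace.
by apply: above_theta_lower => m' m'm; apply: IH => //; apply: (leq_trans m'm).
Qed.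

Lemma theta_monomials (N : MT -> Prop) p u : subspace N ->
  (forall m, N (theta 'X_[m] p u)) -> forall f, N (theta f p u).
Proof.
move=> NS Nm f; rewrite (mpolyE f) (linop_sum (theta_linopl p u)).
apply: subspace_sum => // m _; rewrite (linopZ (theta_linopl p u)).
exact: subspaceZ.
Qed.

Lemma above_submodule : submodule above.
Proof.
apply: submodule_of_stable => [|f u|p u|i j u|f p u au].
- exact: above_subspace.
- by apply: above_linop => [|v]; [apply: actA_linop | rewrite eulerA].
- by apply: above_linop => [|v]; [apply: pder_linop | rewrite euler_pder].
- by apply: above_linop => [|v]; [apply: glop_linop | rewrite euler_glop].
- apply: theta_monomials => [|m]; first exact: above_subspace.
  exact: above_theta_monomial.
Qed.

Hypothesis char0 : [pchar k] =i pred0.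
Variable v : MT.
Hypotheses (v0 : v != 0) (ev : euler v = lam *: v).

Lemma above_theta_eigenvector m p : above (theta 'X_[m] p v).
Proof.
have [D] := ubnP (mdeg m); elim: D m => // D IH m mD.
have [/theta_low_degree ->|m2] := leqP (mdeg m) 1; first exact: above0.
(* The target eigenvalue is lam + |m| - 1, and [aboveS] counts from lam + 1. The condition |m| >= 2
   is what puts it strictly above lam. *)
apply: (@aboveS (mdeg m).-2).
have -> : euler (theta 'X_[m] p v) - (lam + (mdeg m).-2.+1%:R) *: theta 'X_[m] p v =
   - \sum_i (m i)%:R *: actA M 'X_i (theta 'X_[(m - U_(i))%MM] p v).
  rewrite euler_theta ev (linopZ (theta_linop _ _)) (natr_pred (ltnW m2)).
  rewrite [_.-2.+1]prednK; last by rewrite -ltnS prednK // ltnW.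
  by rewrite !scalerDl scale1r; zmodule.
rewrite -scaleN1r; apply: (subspaceZ _ above_subspace).
by apply: above_theta_lower => m' m'm; apply: IH => //; apply: (leq_trans m'm).
Qed.

(** On multiples of [v] the operator in [aboveS] is multiplication by -(d+1), which is injective in
    characteristic 0. *)
Lemma eigenvector_not_above : ~ above v.
Proof.
suff H u : above u -> forall a, u = a *: v -> a = 0.
  by move=> /H/(_ 1); rewrite scale1r => /(_ erefl) /eqP; rewrite oner_eq0.
elim=> [a /esym/eqP|d {}u _ IH a ua].
  by rewrite scaler_eq0 (negPf v0) orbF => /eqP.
have /eqP : - (a * d.+1%:R) = 0.
  apply: IH; rewrite ua (linopZ euler_linop) ev !scalerA -scalerBl.
  by congr (_ *: _); rewrite mulrDl opprD [lam * a]mulrC addrA subrr add0r mulrC.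
by rewrite oppr_eq0 mulf_eq0 (negPf (natr_neq0 char0 d)) orbF => /eqP.
Qed.

Lemma theta_eq0 : simple_mod M -> forall f p u, theta f p u = 0.
Proof.
move=> [_ Msimple].
have above_eq0 u : above u -> u = 0.
  have [|allabove] := Msimple _ above_submodule; first exact.
  by have /eigenvector_not_above := allabove v.
have sub0 : subspace (fun u : MT => u = 0).
  by split=> // a u w -> ->; rewrite scaler0 addr0.
have thetav f p : theta f p v = 0.
  apply: (theta_monomials (N := fun u => u = 0)) f => // m.
  exact/above_eq0/above_theta_eigenvector.
(* [N] is a submodule because brackets with d/dx_j and gl_n turn [theta] into combinations of
   [theta] over A: the part of positive degree is an ideal of L_+. *)
pose N u := forall f p, theta f p u = 0.
have NM : submodule N.
  have NS : subspace N.
    split=> [f p|a u w Nu Nw f p]; first by rewrite (linop0 (theta_linop _ _)).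
    by rewrite theta_linop Nu Nw scaler0 addr0.
  apply: submodule_of_stable NS _ _ _ _ =>
    [f u Nu|p u Nu|i j u Nu|f p u Nu] g q.
  - by rewrite thetaA Nu (linop0 (actA_linop _)).
  - have := pder_theta p g q u; rewrite !Nu (linop0 (pder_linop p)) addr0.
    by move=> <-.
  - have := glop_theta i j g q u; rewrite !Nu (linop0 (glop_linop _ _)).
    by rewrite (linop0 (actA_linop _)) scaler0 !subr0 addr0 => <-.
  - by rewrite Nu (linop0 (theta_linop _ _)).
have [N0|NT] := Msimple _ NM; last by move=> f p u; apply: NT.
by have /eqP := N0 v thetav; rewrite (negPf v0).
Qed.
End Euler.

(** * A smallest gl_n-stable subspace *)

Section Minimal.
Variables (k : closedFieldType) (n : nat) (M : AVmod k n).
Hypothesis char0 : [pchar k] =i pred0.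
Hypotheses (M_simple : simple_mod M) (M_hol : holonomic M).

Lemma simple_holonomic_GKdim : GKdim M = Rbar.Finite (Raxioms.INR n).
Proof.
have [[u u0] _] := M_simple; case: M_hol => [/(_ u) uz|[]//].
by rewrite uz eqxx in u0.
Qed.

(** Minimal dimension replaces simplicity: a proper nonzero stable subspace would have a shorter
    basis. *)
Lemma minimal_gl_stable : exists (d : nat) (w : 'I_d -> AVcar M),
  [/\ (0 < d)%N, indep w, gl_stable w &
      forall d' (w' : 'I_d' -> AVcar M),
        (0 < d')%N -> indep w' -> gl_stable w' -> (d <= d')%N].
Proof.
pose Q d := asb (exists w : 'I_d -> AVcar M, [/\ (0 < d)%N, indep w & gl_stable w]).
have [[u u0] _] := M_simple.
have /(gl_finite char0 u0)[d0 [w0 Hw0]] : Rbar.Rbar_le (GKdim M) (Rbar.Finite (Raxioms.INR n)).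
  by rewrite simple_holonomic_GKdim; apply: Rbar.Rbar_le_refl.
have exQ : exists d, Q d by exists d0; apply/asbP; exists w0.
case: (ex_minnP exQ) => d /asbP[w [dpos wfree wst]] dmin.
exists d, w; split=> // d' w' d'0 w'free w'st.
by apply: dmin; apply/asbP; exists w'.
Qed.

Lemma simple_holonomic_theta f p (u : AVcar M) : theta f p u = 0.
Proof.
have [d [w [d0 wfree wst _]]] := minimal_gl_stable.
have /fin_all_exists[C wC] (b : 'I_d) : exists c : 'I_d -> k, euler (w b) = \sum_a c a *: w a.
  have /fin_all_exists[c Hc] (i : 'I_n) := wst i i b.
  exists (fun a => \sum_i c i a); rewrite /euler (eq_bigr _ (fun i _ => Hc i)) exchange_big.
  by apply: eq_bigr => a _; rewrite scaler_suml.
have [lam [x [x0 xC]]] := exists_eigenvector (\matrix_(b, a) C b a) d0.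
pose v := \sum_b x 0 b *: w b.
apply: (@theta_eq0 _ _ _ lam char0 v) => //.
  apply: contra x0 => /eqP /wfree x0; apply/eqP/rowP => b.
  by rewrite x0 mxE.
rewrite /v (linop_comb (@euler_linop _ _ M)).
under eq_bigr => b _ do rewrite wC scaler_sumr.
rewrite exchange_big scaler_sumr /=; apply: eq_bigr => a _.
have /rowP/(_ a) := xC; rewrite !mxE scalerA => <-.
rewrite scaler_suml; apply: eq_bigr => b _.
by rewrite mxE scalerA.
Qed.
End Minimal.

(** * Matrix units *)

Section Burnside.
Variables (k : closedFieldType) (d : nat).

(** A matrix of maximal rank with row space inside [N] works, since a vector outside its row space
    would increase the rank. *)
Lemma subspace_matrix (N : 'rV[k]_d -> Prop) : subspace N ->
  exists U : 'M[k]_d, forall v, N v <-> (v <= U)%MS.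
Proof.
move=> NS; pose Q r := asb (exists U : 'M[k]_d, \rank U = r /\ forall v, (v <= U)%MS -> N v).
have Q0 : exists r, Q r.
  exists 0%N; apply/asbP; exists 0; rewrite mxrank0; split=> // v.
  by rewrite submx0 => /eqP ->; apply: NS.1.
have Qd r : Q r -> (r <= d)%N by move=> /asbP[U [<- _]]; apply: rank_leq_row.
case: (ex_maxnP Q0 Qd) => r /asbP[U [rU UN]] rmax.
exists U => v; split=> [Nv|]; last exact: UN.
apply/negPn/negP => vU.
have /rank_ltmx : (U < U + v)%MS.
  by rewrite ltmxE addsmxSl /= addsmx_sub submx_refl (negPf vU).
rewrite rU ltnNge rmax //; apply/asbP; exists (U + v)%MS; split=> // x.
move=> /sub_addsmxP[[a b] /= ->]; apply: subspaceD => //.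
  by apply: UN; rewrite submxMl.
by rewrite [b]mx11_scalar mul_scalar_mx; apply: subspaceZ.
Qed.

Variable S : 'M[k]_d -> Prop.
Hypotheses (S1 : S 1%:M) (SL : forall a A B, S A -> S B -> S (a *: A + B)).
Hypothesis SM : forall A B, S A -> S B -> S (A *m B).
Hypothesis Sirr : forall U : 'M[k]_d, (forall A, S A -> stablemx U A) ->
  (U == (0 : 'M[k]_d))%MS || row_full U.
Hypothesis d_gt0 : (0 < d)%N.

Lemma algebra_subspace : subspace S.
Proof. by split=> //; have := SL (-1) S1 S1; rewrite scaleN1r addNr. Qed.

Lemma stable_subspace (N : 'rV[k]_d -> Prop) : subspace N ->
  (forall A v, S A -> N v -> N (v *m A)) ->
  (forall v, N v -> v = 0) \/ (forall v, N v).
Proof.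
move=> NS NA; have [U UN] := subspace_matrix NS.
have /orP[] : (U == (0 : 'M[k]_d))%MS || row_full U.
  apply: Sirr => A SA; apply/row_subP => i; rewrite row_mul.
  by apply/UN/NA => //; apply/UN/row_sub.
  by move=> /eqmxP U0; left=> v /UN; rewrite U0 submx0 => /eqP.
by move=> Uf; right=> v; apply/UN/submx_full.
Qed.

Lemma algebra_transitive (x y : 'rV[k]_d) : x != 0 -> exists2 A, S A & y = x *m A.
Proof.
move=> x0; have [||x0'|//] := @stable_subspace (fun v => exists2 A, S A & v = x *m A).
- split=> [|a u v [A SA ->] [B SB ->]].
    by exists 0; rewrite ?mulmx0 //; apply: algebra_subspace.1.
  by exists (a *: A + B); [apply: SL | rewrite mulmxDr scalemxAr].
- move=> A v SA [B SB ->]; exists (B *m A); [exact: SM | by rewrite mulmxA].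
by move: x0; rewrite (x0' x) ?eqxx //; exists 1%:M; rewrite ?mulmx1.
Qed.

(* A nonzero element [B] of minimal rank satisfies [B A B = lam B] for all
   [A], because [B A] has an eigenvector in the image of [B]. *)
Lemma minimal_rank_sandwich (B : 'M[k]_d) : S B -> B != 0 ->
  (forall C, S C -> C != 0 -> (\rank B <= \rank C)%N) ->
  forall A, S A -> exists lam, B *m A *m B = lam *: B.
Proof.
move=> SB B0 Bmin A SA.
(* [C] is the matrix, in the basis [R], of right multiplication by A B on the row space of [B]. *)
pose R := row_base B; pose C := R *m A *m B *m pinvmx R.
have RC : R *m A *m B = C *m R.
  by rewrite /C mulmxKpV // eq_row_base submxMl.
have r0 : (0 < \rank B)%N by rewrite lt0n mxrank_eq0.
have [lam [z [z0 zC]]] := @exists_eigenvector k _ C r0.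
have /submxP[w wB] : (z *m R <= B)%MS by rewrite -(eq_row_base B) submxMl.
have wB0 : w *m B != 0.
  by rewrite -wB mulmx_free_eq0 // /row_free eq_row_base.
exists lam; apply/eqP; rewrite -subr_eq0; apply/negPn/negP => D0.
set D := _ - _ in D0.
have SD : S D.
  rewrite /D addrC -scaleNr; apply: SL => //.
  by apply: SM => //; apply: SM.
(* The kernel of [D] contains that of [B] and also [w], which [B] does not kill; so [D] has smaller
   rank than [B]. *)
have := Bmin _ SD D0; rewrite leqNgt => /negP[].
have wD : w *m D = 0.
  rewrite /D mulmxBr -scalemxAr !mulmxA -wB -!(mulmxA z) RC.
  by rewrite mulmxA zC -scalemxAl subrr.
have ker_sub : (kermx B <= kermx D)%MS.
  apply/sub_kermxP; rewrite /D mulmxBr !mulmxA -scalemxAr.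
  by rewrite mulmx_ker !mul0mx scaler0 subrr.
have /rank_ltmx : (kermx B < kermx D)%MS.
  rewrite ltmxE ker_sub /=; apply: contra wB0 => /(submx_trans _) H.
  by apply/eqP/sub_kermxP/H/sub_kermxP.
rewrite !mxrank_ker => H.
by move: H; rewrite ltn_sub2lE // rank_leq_row.
Qed.

(** Let r be a nonzero row of a minimal rank [B]. By transitivity the j-th unit vector is r A with A
    in S, so row j of [B] is r A B, and the sandwich identity makes it a multiple of r. *)
Lemma rank_one_element : exists (c : 'cV[k]_d) (e : 'rV[k]_d),
  [/\ c != 0, e != 0 & S (c *m e)].
Proof.
pose Q r := asb (exists B, [/\ S B, B != 0 & \rank B = r]).
have Qex : exists r, Q r.
  exists (\rank (1%:M : 'M[k]_d)); apply/asbP; exists 1%:M; split=> //.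
  by rewrite -mxrank_eq0 mxrank1 -lt0n.
case: (ex_minnP Qex) => r /asbP[B [SB B0 rB]] Bmin.
have sandwich := minimal_rank_sandwich SB B0 _.
have {sandwich} H A : S A -> exists lam, B *m A *m B = lam *: B.
  apply: sandwich => C SC C0; rewrite rB; apply: Bmin.
  by apply/asbP; exists C.
have [i Bi] : exists i, row i B != 0.
  apply/existsP; apply: contraR B0 => /existsPn Bi; apply/eqP/row_matrixP => i.
  by have /negPn/eqP -> := Bi i; rewrite row0.
have /fin_all_exists[c cB] (j : 'I_d) : exists a, row j B = a *: row i B.
  have [A SA jA] := algebra_transitive (delta_mx 0 j) Bi.
  have [lam BAB] := H A SA; exists lam.
  by rewrite [row j B]rowE jA rowE -!mulmxA [B *m (A *m B)]mulmxA BAB -scalemxAr.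
have BE : B = (\col_j c j) *m row i B.
  apply/row_matrixP => j; rewrite cB row_mul; apply/rowP => l.
  by rewrite !mxE big_ord1 !mxE.
exists (\col_j c j), (row i B); rewrite -BE; split=> //.
by apply: contraNneq B0 => c0; rewrite BE c0 mul0mx.
Qed.

Theorem burnside (B : 'M[k]_d) : S B.
Proof.
have [c [e [c0 e0 Sce]]] := rank_one_element.
pose Z (z : 'cV[k]_d) := forall y : 'rV[k]_d, S (z *m y).
have Zc : Z c.
  by move=> y; have [A SA ->] := algebra_transitive y e0; rewrite mulmxA; apply: SM.
(* Irreducibility is about row vectors, so [Z] is shown to contain all columns through its
   annihilator. This is stable because A z lies in [Z] for A in S, and [c] prevents it from being
   everything. *)
pose N (r : 'rV[k]_d) := forall z, Z z -> r *m z = 0.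
have N0 r : N r -> r = 0.
  have [||Nz|NT] := @stable_subspace N.
  - split=> [z _|a u v Nu Nv z Zz]; first by rewrite mul0mx.
    by rewrite mulmxDl -scalemxAl Nu // Nv // scaler0 addr0.
  - move=> A v SA Nv z Zz; rewrite -mulmxA; apply: Nv => y.
    by rewrite -mulmxA; apply: SM.
  - exact: Nz.
  have /eqP[] := c0; apply/row_matrixP => i.
  by rewrite rowE NT // row0.
have [|U UZ] := @subspace_matrix (fun v => Z v^T) _.
  have : subspace Z.
    split=> [y|a u v Zu Zv y]; first by rewrite mul0mx; apply: algebra_subspace.1.
    by rewrite mulmxDl -scalemxAl; apply: SL.
  by move=> ZS; apply: (subspace_preim _ ZS) => a u v; rewrite linearP.
have Ufull : row_full U.
  rewrite /row_full -mxrank_tr -[_ == _]/(row_free U^T) -kermx_eq0.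
  apply/eqP/row_matrixP => i; rewrite row0; apply: N0 => z Zz.
  have /submxP[a za] : (z^T <= U)%MS by apply/UZ; rewrite trmxK.
  rewrite -[z]trmxK za trmx_mul mulmxA.
  have /sub_kermxP -> : (row i (kermx U^T) <= kermx U^T)%MS by apply: row_sub.
  by rewrite mul0mx.
have ZT z : Z z by rewrite -[z]trmxK; apply/UZ/submx_full.
have -> : B = \sum_j col j B *m delta_mx 0 j.
  apply/matrixP => i j; rewrite summxE (bigD1 j) //= big1 ?addr0 => [|l lj].
    by rewrite !mxE big_ord1 !mxE !eqxx mulr1.
  by rewrite !mxE big_ord1 !mxE [j == l]eq_sym (negPf lj) andbF mulr0.
by apply: subspace_sum => [|j _]; [apply: algebra_subspace | apply: ZT].
Qed.
End Burnside.

(** * Representation of gl_n on W and matrix units on M *)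

Section GlRepresentation.
Variables (k : closedFieldType) (n d : nat) (M : AVmod k n).
Local Notation MT := (AVcar M).
Hypotheses (M_simple : simple_mod M) (theta0 : forall f p (u : MT), theta f p u = 0).
Variables (w : 'I_d -> MT) (R : 'I_n -> 'I_n -> 'M[k]_d).
Hypotheses (d_gt0 : (0 < d)%N) (w_free : indep w).
Hypothesis w_min : forall d' (w' : 'I_d' -> MT),
  (0 < d')%N -> indep w' -> gl_stable w' -> (d <= d')%N.
Hypothesis glop_w : forall i j b, glop i j (w b) = \sum_a R i j a b *: w a.

(* [T] is a noncommutative polynomial in the operators [glop i j], and [B] is
   the same polynomial in the matrices [R i j]. *)
Inductive represents : (MT -> MT) -> 'M[k]_d -> Prop :=
| rep_id : represents id 1%:M
| rep_glop i j : represents (glop i j) (R i j)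
| rep_comb a T B T' B' : represents T B -> represents T' B' ->
    represents (fun u => a *: T u + T' u) (a *: B + B')
| rep_comp T B T' B' : represents T B -> represents T' B' ->
    represents (fun u => T (T' u)) (B *m B')
| rep_ext T T' B : represents T B -> T =1 T' -> represents T' B.

Lemma represents_linop T B : represents T B -> linop T.
Proof.
elim=> {T B} // [i j|a T B T' B' _ TL _ T'L|T B T' B' _ TL _ T'L|T T' B _ TL TT'].
- exact: glop_linop.
- by apply: linopD_op => //; apply: linopZ_op.
- exact: linop_comp.
- by move=> a u v; rewrite -!TT' TL.
Qed.

Lemma representsA T B : represents T B -> forall f u, T (actA M f u) = actA M f (T u).
Proof.
elim=> {T B} // [i j|a T B T' B' _ TA _ T'A|T B T' B' _ TA _ T'A|T T' B _ TA TT'] f u.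
- exact: glopA.
- by rewrite TA T'A actA_linr.
- by rewrite T'A TA.
- by rewrite -!TT' TA.
Qed.

Lemma represents_pder T B : represents T B -> forall p u, T (pder p u) = pder p (T u).
Proof.
elim=> {T B} // [i j|a T B T' B' _ TA _ T'A|T B T' B' _ TA _ T'A|T T' B _ TA TT'] p u.
- by rewrite pder_glop.
- by rewrite TA T'A pder_linop.
- by rewrite T'A TA.
- by rewrite -!TT' TA.
Qed.

Lemma represents_w T B : represents T B -> forall b, T (w b) = \sum_a B a b *: w a.
Proof.
elim=> {T B} [b|i j b|a T B T' B' _ IH _ IH' b|T B T' B' rT IH _ IH' b|T T' B _ IH TT' b].
- under eq_bigr => a _ do rewrite mxE.
  by rewrite (sum_delta b w).
- exact: glop_w.
- rewrite IH IH' scaler_sumr -big_split; apply: eq_bigr => c _.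
  by rewrite !mxE scalerDl scalerA.
- rewrite IH' (linop_comb (represents_linop rT)).
  under eq_bigr => a _ do rewrite IH scaler_sumr.
  rewrite exchange_big; apply: eq_bigr => c _; rewrite mxE scaler_suml.
  by apply: eq_bigr => a _; rewrite scalerA mulrC.
- by rewrite -TT' IH.
Qed.

Lemma represents_sum (I : Type) (r : seq I) (c : I -> k) T B :
  (forall i, represents (T i) (B i)) ->
  represents (fun u => \sum_(i <- r) c i *: T i u) (\sum_(i <- r) c i *: B i).
Proof.
move=> rT; elim: r => [|i r IH].
  rewrite big_nil -(addNr 1%:M) -scaleN1r; apply: rep_ext (rep_comb _ rep_id rep_id) _ => u.
  by rewrite big_nil scaleN1r addNr.
rewrite big_cons; apply: rep_ext (rep_comb _ (rT i) IH) _ => u.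
by rewrite big_cons.
Qed.

(** The vectors killed by every operator representing 0 form a submodule containing [w], hence all
    of M: a relation valid on W holds on M. *)
Lemma represents_eq0 T u : represents T 0 -> T u = 0.
Proof.
pose N u := forall T, represents T 0 -> T u = 0.
suff /(_ u) H : forall u, N u by move=> /H.
have NS : subspace N.
  split=> [T' rT|a x y Nx Ny T' rT]; first by rewrite (linop0 (represents_linop rT)).
  by rewrite (represents_linop rT) Nx // Ny // scaler0 addr0.
have NM : submodule N.
  apply: submodule_of_stable NS _ _ _ _ => [f x Nx|p x Nx|i j x Nx|f p x Nx] T' rT.
  - by rewrite (representsA rT) Nx // (linop0 (actA_linop f)).
  - by rewrite (represents_pder rT) Nx // (linop0 (pder_linop p)).
  - apply: (Nx (fun x => T' (glop i j x))); rewrite -[0](mul0mx _ (R i j)).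
    by apply: rep_comp => //; apply: rep_glop.
  - by rewrite theta0 (linop0 (represents_linop rT)).
have [N0|//] := M_simple.2 _ NM.
have w0 : w (Ordinal d_gt0) = 0.
  apply: N0 => T' /represents_w ->; rewrite big1 // => a _.
  by rewrite mxE scale0r.
have := @w_free (fun i => (i == Ordinal d_gt0)%:R).
rewrite sum_delta => /(_ w0 (Ordinal d_gt0)) /eqP.
by rewrite eqxx oner_eq0.
Qed.

Lemma represents_inj T T' B B' : represents T B -> represents T' B' ->
  (forall u, T u = T' u) <-> B = B'.
Proof.
move=> rT rT'; split=> [TT'|BB' u].
  apply/matrixP => a b; apply/eqP; rewrite -subr_eq0; apply/eqP.
  apply: (w_free (c := fun a => B a b - B' a b)).
  under eq_bigr => c _ do rewrite scalerBl.
  by rewrite sumrB -(represents_w rT) -(represents_w rT') TT' subrr.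
have := rep_comb (-1) rT' rT; rewrite BB' scaleN1r addNr => /(represents_eq0 u).
by rewrite scaleN1r addrC => /eqP; rewrite subr_eq0 => /eqP.
Qed.

(** This is [glopC] carried over to matrices by [represents_inj]. *)
Lemma R_commutator i j l p : R i j *m R l p - R l p *m R i j =
  (l == j)%:R *: R i p - (p == i)%:R *: R l j.
Proof.
apply/eqP; rewrite subr_eq addrC addrA -scaleNr [_ + _ *: _ + _]addrC.
have r1 := rep_comp (rep_glop i j) (rep_glop l p).
have r2 := rep_comp (rep_glop l p) (rep_glop i j).
have r3 := rep_comb (l == j)%:R (rep_glop i p) r2.
have r4 := rep_comb (- (p == i)%:R) (rep_glop l j) r3.
apply/eqP; rewrite [_ *m _ + _]addrC; apply/(represents_inj r1 r4) => u.
by rewrite glopC scaleNr; zmodule.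
Qed.

Definition gl_matrix (X : 'M[k]_n) : 'M[k]_d := \sum_i \sum_j X i j *: R i j.

Lemma gl_matrix_delta i j : gl_matrix (delta_mx i j) = R i j.
Proof.
rewrite /gl_matrix -[RHS](sum_delta i (fun l => R l j)); apply: eq_bigr => l _.
rewrite -[in RHS](sum_delta j (fun p => R l p)) scaler_sumr; apply: eq_bigr => p _.
by rewrite mxE scalerA -natrM mulnb.
Qed.

Lemma gl_matrix_linop : linop gl_matrix.
Proof.
move=> a X Y; rewrite /gl_matrix scaler_sumr -big_split; apply: eq_bigr => i _.
rewrite scaler_sumr -big_split; apply: eq_bigr => j _.
by rewrite !mxE scalerDl scalerA.
Qed.

Lemma gl_matrixM (X Y : 'M[k]_n) : gl_matrix (X *m Y) = \sum_i \sum_j \sum_l \sum_p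
  (X i j * Y l p) *: ((l == j)%:R *: R i p).
Proof.
apply: eq_bigr => i _; under [RHS]eq_bigr => j _ do rewrite exchange_big.
rewrite [RHS]exchange_big; apply: eq_bigr => p _.
rewrite mxE scaler_suml; apply: eq_bigr => j _.
rewrite -[LHS](sum_delta j (fun l => (X i j * Y l p) *: R i p)).
by apply: eq_bigr => l _; rewrite !scalerA mulrC.
Qed.

Lemma gl_matrix_rep : gl_rep gl_matrix.
Proof.
split=> [|X Y]; first exact: gl_matrix_linop.
have E (Z T : 'M[k]_n) : gl_matrix Z *m gl_matrix T =
    \sum_i \sum_j \sum_l \sum_p (Z i j * T l p) *: (R i j *m R l p).
  rewrite mulmx_suml; apply: eq_bigr => i _; rewrite mulmx_suml; apply: eq_bigr => j _.
  rewrite mulmx_sumr; apply: eq_bigr => l _; rewrite mulmx_sumr; apply: eq_bigr => p _.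
  by rewrite -scalemxAl -scalemxAr scalerA.
have swap (F : 'I_n -> 'I_n -> 'I_n -> 'I_n -> 'M[k]_d) :
    \sum_i \sum_j \sum_l \sum_p F i j l p = \sum_i \sum_j \sum_l \sum_p F l p i j.
  under eq_bigr => i _ do rewrite exchange_big.
  rewrite exchange_big; apply: eq_bigr => l _.
  under eq_bigr => i _ do rewrite exchange_big.
  by rewrite exchange_big.
rewrite (linopB gl_matrix_linop) !gl_matrixM !E (swap (fun i j l p => (Y i j * X l p) *: _)).
rewrite (swap (fun i j l p => (Y i j * X l p) *: (R i j *m R l p))).
rewrite -!sumrB; apply: eq_bigr => i _; rewrite -!sumrB; apply: eq_bigr => j _.
rewrite -!sumrB; apply: eq_bigr => l _; rewrite -!sumrB; apply: eq_bigr => p _.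
by rewrite [Y l p * _]mulrC -!scalerBr R_commutator [i == p]eq_sym.
Qed.

Definition vec_w (x : 'rV[k]_d) : MT := \sum_b x 0 b *: w b.

Lemma vec_w_linop : linop vec_w.
Proof.
move=> a x y; rewrite /vec_w scaler_sumr -big_split; apply: eq_bigr => b _.
by rewrite !mxE scalerDl scalerA.
Qed.

Lemma vec_w_inj x : vec_w x = 0 -> x = 0.
Proof. by move=> /w_free x0; apply/rowP => b; rewrite x0 mxE. Qed.

Lemma glop_vec_w i j x : glop i j (vec_w x) = vec_w (x *m (R i j)^T).
Proof.
rewrite /vec_w (linop_comb (glop_linop i j)).
under eq_bigr => b _ do rewrite glop_w scaler_sumr.
rewrite exchange_big; apply: eq_bigr => a _; rewrite mxE scaler_suml.
by apply: eq_bigr => b _; rewrite mxE scalerA.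
Qed.

(** A nonzero stable [U] yields a stable independent family of size its rank, so [w_min] forces full
    rank. Transposes appear because coordinates are row vectors here. *)
Lemma gl_matrix_simple : gl_simple gl_matrix.
Proof.
split=> // U Ust; have [->|U0] := eqVneq U 0; first by rewrite submx_refl.
apply/orP; right; rewrite /row_full eqn_leq rank_leq_row /=.
apply: (w_min (w' := fun c => vec_w (row c (row_base U)))).
- by rewrite lt0n mxrank_eq0.
- move=> c; rewrite -(linop_comb vec_w_linop) => /vec_w_inj H.
  have cU : (\row_i c i) *m row_base U = 0.
    by rewrite mulmx_sum_row -[RHS]H; apply: eq_bigr => i _; rewrite mxE.
  have : (\row_i c i) == 0 by rewrite -(mulmx_free_eq0 _ (row_base_free U)) cU.
  by move=> /eqP/rowP c0 i; have := c0 i; rewrite !mxE.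
move=> i j c.
have /submxP[x Hx] : (row c (row_base U) *m (R i j)^T <= row_base U)%MS.
  rewrite eq_row_base; apply: submx_trans (Ust (delta_mx i j)).
  rewrite gl_matrix_delta submxMr // -(eq_row_base U); exact: row_sub.
exists (fun a => x 0 a); rewrite glop_vec_w Hx mulmx_sum_row.
exact: (linop_comb vec_w_linop).
Qed.

Lemma exists_matrix_units : exists E : 'I_d -> 'I_d -> MT -> MT,
  forall a b, represents (E a b) (delta_mx a b).
Proof.
(* The transpose matches the row vectors of [burnside] to the convention of [gl_simple]; it also
   reverses the order of composition. *)
pose S (B : 'M[k]_d) := exists T, represents T B^T.
have SB B : S B.
  apply: (@burnside k d S) => //.
  - by exists id; rewrite trmx1; apply: rep_id.
  - move=> a A B' [T rT] [T' rT']; exists (fun u => a *: T u + T' u).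
    by rewrite linearP; apply: rep_comb.
  - move=> A B' [T rT] [T' rT']; exists (fun u => T' (T u)).
    by rewrite trmx_mul; apply: rep_comp.
  move=> U Ust; apply: gl_matrix_simple.2 => X.
  have RU i j : stablemx U (R i j)^T.
    by apply: Ust; exists (glop i j); rewrite trmxK; apply: rep_glop.
  rewrite /gl_matrix linear_sum mulmx_sumr; apply: summx_sub => i _.
  rewrite linear_sum mulmx_sumr; apply: summx_sub => j _.
  by rewrite linearZ -scalemxAr; apply: scalemx_sub; apply: RU.
have /fin_all_exists[E HE] (ab : 'I_d * 'I_d) := SB (delta_mx ab.2 ab.1).
by exists (fun a b => E (a, b)) => a b; have := HE (a, b); rewrite trmx_delta.
Qed.
Variable E : 'I_d -> 'I_d -> MT -> MT.
Hypothesis rE : forall a b, represents (E a b) (delta_mx a b).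

Lemma matrix_units_mul a b c e u : E a b (E c e u) = (b == c)%:R *: E a e u.
Proof.
have r1 := rep_comp (rE a b) (rE c e).
(* A sum with one term, serving as a scalar multiple. *)
have r2 := @represents_sum unit [:: tt] (fun _ => (b == c)%:R) _ _ (fun _ => rE a e).
rewrite (represents_inj r1 r2).2; first by rewrite big_seq1.
by rewrite big_seq1 mul_delta_mx_cond scaler_nat.
Qed.

Lemma matrix_units_sum u : \sum_a E a a u = u.
Proof.
have r := represents_sum (index_enum 'I_d) (fun _ => 1) (fun a => rE a a).
under eq_bigr => a _ do rewrite -[E _ _ _]scale1r.
apply: (represents_inj r rep_id).2; rewrite mx1_sum_delta.
by apply: eq_bigr => a _; rewrite scale1r.
Qed.

Lemma matrix_units_glop i j u : glop i j u = \sum_a \sum_b R i j a b *: E a b u.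
Proof.
rewrite pair_bigA.
have r := represents_sum (index_enum ('I_d * 'I_d)%type) (fun ab => R i j ab.1 ab.2)
  (fun ab => rE ab.1 ab.2).
apply: (represents_inj (rep_glop i j) r).2.
by rewrite [LHS]matrix_sum_delta pair_bigA.
Qed.
End GlRepresentation.

(** * The tensor decomposition *)

Section FixedSpace.
Variables (k : fieldType) (V : lmodType k) (e : V -> V) (eL : linop e).

(** For an idempotent [e] this is its image. The proof of linearity is a parameter so that the
    closure instance can be attached to the predicate. *)
Definition fix_pred of linop e : {pred V} := fun u => e u == u.

Fact fix_pred_submod : submod_closed (fix_pred eL).
Proof.
split=> [|a u v]; rewrite !unfold_in; first by rewrite (linop0 eL).
by move=> /eqP eu /eqP ev; rewrite eL eu ev.
Qed.
HB.instance Definition _ := GRing.isSubmodClosed.Build k V (fix_pred eL) fix_pred_submod.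

Record fixed_space := FixedSpace { fixed_val : V; _ : fixed_val \in fix_pred eL }.
HB.instance Definition _ := [isSub for fixed_val].
HB.instance Definition _ := [Choice of fixed_space by <:].
HB.instance Definition _ := [SubChoice_isSubLmodule of fixed_space by <:].

Lemma fixed_valP (p : fixed_space) : e (val p) = val p.
Proof. by case: p => u /= /eqP. Qed.
End FixedSpace.

Section WeylFixed.
Variables (k : fieldType) (n : nat) (M : AVmod k n).
Local Notation MT := (AVcar M).
Variable e : MT -> MT.
Hypotheses (eL : linop e) (eA : forall f u, e (actA M f u) = actA M f (e u)).
Hypothesis ed : forall p u, e (pder p u) = pder p (e u).
Implicit Types (u v : MT) (f : {mpoly k[n]}) (eta xi : Vder k n).

(** The vector field acting through the factor D alone. *)
Definition weylV eta u : MT := \sum_p actA M (eta p) (pder p u).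

Lemma weylV_linop eta : linop (weylV eta).
Proof.
apply: linop_sum_op => p.
by apply: linop_comp; [apply: actA_linop | apply: pder_linop].
Qed.

Lemma weylV_linopl u : linop (fun eta => weylV eta u).
Proof.
move=> a eta xi; rewrite /weylV scaler_sumr -big_split; apply: eq_bigr => p _.
by rewrite !ffunE actA_linl.
Qed.

Lemma weylVA eta f u : weylV eta (actA M f u) = actA M (der eta f) u + actA M f (weylV eta u).
Proof.
rewrite /der (linop_sum (actA_linopl u)) (linop_sum (actA_linop f)) -big_split.
apply: eq_bigr => p _; rewrite pderA (linopD (actA_linop _)) -!actAM.
by rewrite [f * _]mulrC.
Qed.

Lemma weylV_lie eta xi u :
  weylV (lieV eta xi) u = weylV eta (weylV xi u) - weylV xi (weylV eta u).
Proof.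
have E eta1 xi1 : weylV eta1 (weylV xi1 u) = \sum_p actA M (der eta1 (xi1 p)) (pder p u)
    + \sum_p \sum_q actA M (eta1 q * xi1 p) (pder q (pder p u)).
  rewrite {2}/weylV (linop_sum (weylV_linop _)) -big_split; apply: eq_bigr => p _.
  rewrite weylVA /weylV (linop_sum (actA_linop _)); congr (_ + _).
  by apply: eq_bigr => q _; rewrite actAC -actAM.
(* The second order terms of the two composites agree after exchanging p and q, since the d/dx_p
   commute. *)
rewrite !E [X in _ - (_ + X)]exchange_big /=.
under [X in _ - (_ + X)]eq_bigr => p _ do under eq_bigr => q _ do rewrite mulrC pderC.
rewrite opprD addrACA subrr addr0 -sumrB; apply: eq_bigr => p _.
by rewrite ffunE (linopB (actA_linopl _)).
Qed.

Lemma fix_predP u : reflect (e u = u) (u \in fix_pred eL).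
Proof. exact: eqP. Qed.

Lemma fixA f (p : fixed_space eL) : actA M f (val p) \in fix_pred eL.
Proof. by apply/fix_predP; rewrite eA fixed_valP. Qed.

Lemma e_weylV eta u : e (weylV eta u) = weylV eta (e u).
Proof. by rewrite (linop_sum eL); apply: eq_bigr => p _; rewrite eA ed. Qed.

Lemma fixV eta (p : fixed_space eL) : weylV eta (val p) \in fix_pred eL.
Proof. by apply/fix_predP; rewrite e_weylV fixed_valP. Qed.

Definition fixed_actA f p : fixed_space eL := FixedSpace (fixA f p).
Definition fixed_actV eta p : fixed_space eL := FixedSpace (fixV eta p).

Definition fixed_module : AVmod k n.
Proof.
refine (@Build_AVmod k n (fixed_space eL) fixed_actA fixed_actV _ _ _ _ _ _ _ _).
- by move=> f a p q; apply: val_inj; apply: actA_linr.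
- by move=> a f g p; apply: val_inj; apply: actA_linl.
- by move=> p; apply: val_inj; apply: actA1.
- by move=> f g p; apply: val_inj; apply: actAM.
- by move=> eta a p q; apply: val_inj; apply: weylV_linop.
- by move=> a eta xi p; apply: val_inj; apply: weylV_linopl.
- by move=> eta xi p; apply: val_inj; apply: weylV_lie.
- by move=> eta f p; apply: val_inj; apply: weylVA.
Defined.

Lemma fixed_module_Dmod : is_Dmod fixed_module.
Proof.
move=> f eta p; apply: val_inj; rewrite /= /weylV (linop_sum (actA_linop f)).
by apply: eq_bigr => q _; rewrite ffunE actAM.
Qed.

Local Notation P := fixed_module.
Definition fval : AVcar P -> MT := @fixed_val k MT e eL.

Lemma fval_linop : linop fval. Proof. by []. Qed.

Lemma gk_exponent_fixed_le fs etas (M0 : seq (AVcar P)) (q : nat) :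
  Rbar.Rbar_le (GKdim M) (Rbar.Finite (Raxioms.INR q)) ->
  Rbar.Rbar_le (gk_exponent fs etas M0) (Rbar.Finite (Raxioms.INR q)).
Proof.
move=> GK.
(* A field acts on the fixed space as a sum of eta_i d/dx_i. With the coefficients adjoined, each
   letter there costs at most two letters in M. *)
pose fs' := fs ++ [seq (eta : Vder k n) i | eta <- etas, i <- enum 'I_n].
pose M0' := map fval M0.
have H m (v : AVcar P) : v \in words (opsof P fs etas) M0 m ->
    inspan (words (opsof M fs' (partials k n)) M0' (m.*2)) (fval v).
  move: m v; apply: words_ind => [v vM|m v|m f v ffs|m eta v etas_eta].
  - by apply: mem_inspan; apply: map_f.
  - by apply: inspan_words_mono; rewrite leq_double.
  - move=> Hv; rewrite doubleS; apply: inspan_words_mono (leqnSn _) _.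
    by apply: inspan_words_actA Hv; rewrite mem_cat ffs.
  - move=> Hv; apply: subspace_sum => [|p _]; first exact: inspan_subspace.
    rewrite doubleS; apply: inspan_words_actA.
      rewrite mem_cat; apply/orP; right; apply/allpairsP; exists (eta, p).
      by rewrite mem_enum.
    by apply: inspan_words_actV Hv; apply: mem_partials.
apply: Growth.growth_le_double (RIneq.pos_INR q) _
  (Rbar.Rbar_le_trans _ _ _ (gk_exponent_le fs' (partials k n) M0') GK) => m.
apply/leP; have [b [<- bfree bs _]] := dimspan_basis (words (opsof P fs etas) M0 m).
rewrite -[size b]card_ord; apply: (@indep_le_dimspan k n M _ (fun i : 'I_(size b) => fval b`_i)).
  move=> c; rewrite -(linop_comb fval_linop) => Hc; apply: bfree.
  by apply: val_inj; apply: Hc.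
move=> i; rewrite multE mul2n; apply: H; apply: bs; exact: mem_nth.
Qed.
End WeylFixed.

(** * Holonomicity of a simple module from an upper bound on growth *)

Section Holonomic.
Variables (k : fieldType) (n : nat) (char0 : [pchar k] =i pred0).

Lemma simple_fin_gen (P : AVmod k n) : simple_mod P -> fin_gen P.
Proof.
move=> [[u u0] Psimple]; exists [:: u] => N NP Nu.
have [N0|//] := Psimple N NP; have /eqP := N0 u (Nu u (mem_head u [::])).
by rewrite (negPf u0).
Qed.

Lemma GKdim_ge (P : AVmod k n) (u : AVcar P) : u != 0 ->
  Rbar.Rbar_le (Rbar.Finite (Raxioms.INR n)) (GKdim P).
Proof.
move=> u0.
pose D m := dimspan (words (opsof P (coords k n) (partials k n)) [:: u] m).
have HD s : Peano.le (Nat.pow s.+1 (n + n)) (Nat.pow (D (Nat.mul (2 * (n + n) + 2)%N s)) 2).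
  rewrite -!expn_pow; apply/leP.
  (* The identity is the only extra operator, so the count is (s+1)^(2n) and the exponent is n. *)
  have := @bernstein_inequality k n char0 P (partials k n) u 0 unit (fun _ => id) s.
  rewrite card_unit muln1; move=> H; apply: leq_trans (H _ _ _ _ _ _) _ => //.
  - by move=> _ m v; rewrite addn0; apply: mem_inspan.
  - move=> c; rewrite (bigD1 tt) //= big1 ?addr0 => [|[]] // /eqP.
    by rewrite scaler_eq0 (negPf u0) orbF => /eqP c0 [].
  rewrite leq_exp2r //; apply: dimspan_mono; apply: words_mono.
  by rewrite multE addn0 -mulnDl leq_mul2r mul2n -addnn leq_addr orbT.
(* The summand 2 keeps the factor at least 2 even for n = 0. *)
have q2 : Peano.le 2 (2 * (n + n) + 2)%N by apply/leP; rewrite leq_addl.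
apply: Rbar.Rbar_le_trans (gk_exponent_le (coords k n) (partials k n) [:: u]).
have := Growth.half_power_le_growth _ _ _ q2 HD.
congr (Rbar.Rbar_le (Rbar.Finite _) _); rewrite RIneq.plus_INR.
by rewrite -[RHS]RIneq.Rmult_1_r; Lra.lra.
Qed.

Lemma simple_holonomic (P : AVmod k n) : simple_mod P ->
  (forall fs etas (M0 : seq (AVcar P)),
     Rbar.Rbar_le (gk_exponent fs etas M0) (Rbar.Finite (Raxioms.INR n))) ->
  holonomic P.
Proof.
move=> Psimple Ple; right; split; first exact: simple_fin_gen.
have [[u u0] _] := Psimple; apply: Rbar.Rbar_le_antisym; last exact: GKdim_ge u0.
rewrite /GKdim /Lub.Rbar_lub; case: Lub.Rbar_ex_lub => l [_ lmin] /=.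
by apply: lmin => x [fs [etas [M0 ->]]].
Qed.
End Holonomic.

(** * The tensor action when L_+ acts through gl_n *)

Section TensorAction.
Variables (k : fieldType) (n d : nat) (P : AVmod k n) (rho : 'M[k]_n -> 'M[k]_d).
Hypothesis rho0 : rho 0 = 0.

Lemma sum_degree1 (V : zmodType) D (F : 'X_{1..n} -> V) :
  (forall m, mdeg m != 1%N -> F m = 0) ->
  \sum_(m : 'X_{1..n < D.+2} | m != 0%MM :> 'X_{1..n}) F m = \sum_l F U_(l)%MM.
Proof.
move=> F0; have U_lt (l : 'I_n) : (mdeg U_(l)%MM < D.+2)%N by rewrite mdeg1.
pose h l : 'X_{1..n < D.+2} := BMultinom (U_lt l).
have h_inj : injective h.
  by move=> i j /(congr1 val) /= /mnmP/(_ i); rewrite !mnm1E eqxx; case: eqP.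
transitivity (\sum_(m in [set h l | l : 'I_n]) F m); last first.
  by rewrite big_imset //=; move=> i j _ _; apply: h_inj.
rewrite big_mkcond [RHS]big_mkcond; apply: eq_bigr => m _.
have [m1|m1] := eqVneq (mdeg m) 1%N; last by rewrite F0 // !if_same.
have /eqP/mdeg1P[l /eqP ml] := m1.
rewrite -mdeg_eq0 m1 /=; have -> // : m \in [set h l | l : 'I_n].
by apply/imsetP; exists l => //; apply: val_inj.
Qed.

Lemma projL0_U (l p : 'I_n) : projL0 k U_(l)%MM p = delta_mx l p.
Proof.
rewrite /projL0 mdeg1 eqxx; apply/matrixP => i j.
by rewrite !mxE mnm1E eq_sym -natrM mulnb.
Qed.

Lemma tens_op0 g (u : 'I_d -> AVcar P) i : tens_op g 0 u i = 0.
Proof. by rewrite /tens_op big1 // => j _; rewrite mxE scale0r. Qed.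

(* Only the monomials [m] of degree one contribute, since [projL0] kills the
   others; the binomial coefficient is then the exponent of [X_l] in [K]. *)
Lemma tensVE eta (u : 'I_d -> AVcar P) i : tensV rho eta u i =
  actV P eta (u i) + \sum_p \sum_l tens_op (mderiv l (eta p)) (rho (delta_mx l p)) u i.
Proof.
congr (_ + _); apply: eq_bigr => p _.
transitivity (\sum_(K <- msupp (eta p)) \sum_l ((eta p)@_K * (K l)%:R) *:
    tens_op 'X_[(K - U_(l))%MM] (rho (delta_mx l p)) u i).
  apply: eq_bigr => K _.
  case DK : (mdeg K) => [|D].
    (* For K = 0 no nonzero m has degree at most |K|, and all K l vanish; otherwise the degree bound
       is at least 2, as [sum_degree1] requires. *)
    rewrite big1 ?big1 // => [l _|m m0].
      move/eqP: DK; rewrite mdeg_eq0 => /eqP ->.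
      by rewrite mnm0E mulr0 scale0r.
    by have := bmdeg m; rewrite ltnS leqn0 mdeg_eq0 (negPf m0).
  rewrite (@sum_degree1 _ D (fun m => (eta p)@_K *: ((\prod_(l < n) 'C(K l, m l))%:R *:
             tens_op 'X_[(K - m)%MM] (rho (projL0 k m p)) u i))).
    apply: eq_bigr => l _; rewrite projL0_U scalerA; congr (_ * _%:R *: _).
    rewrite (bigD1 l) //= mnm1E eqxx bin1 big1 ?muln1 // => j jl.
    by rewrite mnm1E eq_sym (negPf jl) bin0.
  by move=> m /negPf m1; rewrite /projL0 m1 rho0 tens_op0 !scaler0.
rewrite exchange_big; apply: eq_bigr => l _.
rewrite /mderiv /tens_op; under [LHS]eq_bigr => K _ do rewrite scaler_sumr.
rewrite exchange_big; apply: eq_bigr => j _.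
rewrite (linop_sum (actA_linopl _)) scaler_sumr; apply: eq_bigr => K _.
by rewrite (linopZ (actA_linopl _)) !scalerA mulrC [_ * (K l)%:R]mulrC.
Qed.
End TensorAction.

(** * Splitting M by matrix units *)

Section Decomposition.
Variables (k : closedFieldType) (n d : nat) (M : AVmod k n).
Local Notation MT := (AVcar M).
Hypotheses (M_simple : simple_mod M) (theta0 : forall f p (u : MT), theta f p u = 0).
Variables (R : 'I_n -> 'I_n -> 'M[k]_d) (E : 'I_d -> 'I_d -> MT -> MT) (o : 'I_d).
Hypothesis E_linop : forall a b, linop (E a b).
Hypothesis EA : forall a b f u, E a b (actA M f u) = actA M f (E a b u).
Hypothesis Ed : forall a b p u, E a b (pder p u) = pder p (E a b u).
Hypothesis EE : forall a b c e u, E a b (E c e u) = (b == c)%:R *: E a e u.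
Hypothesis E1 : forall u, \sum_a E a a u = u.
Hypothesis glopE : forall i j u, glop i j u = \sum_a \sum_b R i j a b *: E a b u.
Variable rho : 'M[k]_n -> 'M[k]_d.
Hypotheses (rho0 : rho 0 = 0) (rho_delta : forall i j, rho (delta_mx i j) = R i j).
Implicit Types u v : MT.

Definition mult_space : AVmod k n := fixed_module (E_linop o o) (EA o o) (Ed o o).
Local Notation P := mult_space.

Fact E_fixed a u : E o a u \in fix_pred (E_linop o o).
Proof. by apply/fix_predP; rewrite EE eqxx scale1r. Qed.

(** [E o a] carries the a-th summand of M to the o-th one; [E a o] carries it back. *)
Definition tensor_iso u (a : 'I_d) : AVcar P := FixedSpace (E_fixed a u).

Lemma fval_iso u a : fval (tensor_iso u a) = E o a u. Proof. by []. Qed.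

Lemma tensor_iso_linop a : linop (fun u => tensor_iso u a).
Proof. by move=> c u v; apply: val_inj; apply: E_linop. Qed.

Lemma tensor_isoK u : \sum_a E a o (fval (tensor_iso u a)) = u.
Proof.
by rewrite -[RHS]E1; apply: eq_bigr => a _; rewrite fval_iso EE eqxx scale1r.
Qed.

Lemma tensor_iso_inj : injective tensor_iso.
Proof. by move=> u v uv; rewrite -[u]tensor_isoK -[v]tensor_isoK uv. Qed.

Lemma tensor_iso_surj (w : 'I_d -> AVcar P) : exists u, tensor_iso u = w.
Proof.
exists (\sum_a E a o (fval (w a))).
apply: FunctionalExtensionality.functional_extensionality => i.
apply: val_inj; rewrite /= (linop_sum (E_linop o i)).
under eq_bigr => a _ do rewrite EE eq_sym.
rewrite (sum_delta i (fun a => E o o (fval (w a)))).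
exact: (fixed_valP (w i)).
Qed.

Lemma tensor_iso_actA f u : tensor_iso (actA M f u) = tensA f (tensor_iso u).
Proof.
apply: FunctionalExtensionality.functional_extensionality => i.
by apply: val_inj; apply: EA.
Qed.

Lemma tensor_iso_actV eta u : tensor_iso (actV M eta u) = tensV rho eta (tensor_iso u).
Proof.
apply: FunctionalExtensionality.functional_extensionality => i.
have fL := @fval_linop k n M (E o o) (E_linop o o) (EA o o) (Ed o o).
apply: val_inj; rewrite (tensVE rho0) [LHS]/=.
rewrite -[RHS]/(fval _) (linopD fL) (linop_sum fL).
rewrite -big_split actVE (linop_sum (E_linop o i)); apply: eq_bigr => p _.
rewrite theta0 addr0 (linopD (E_linop o i)) EA Ed; congr (_ + _).
rewrite (linop_sum (E_linop o i)) (linop_sum fL); apply: eq_bigr => l _.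
rewrite EA glopE rho_delta /tens_op (linop_comb fL).
rewrite (linop_sum (E_linop o i)).
(* E_oi E_ab is E_ob if a = i and 0 otherwise, so only row i of the matrix survives. *)
rewrite (eq_bigr (fun a => (a == i)%:R *: \sum_b R l p a b *: E o b u)).
  rewrite (sum_delta i (fun a => \sum_b R l p a b *: E o b u)).
  exact: (linop_comb (actA_linop _)).
move=> a _; rewrite (linop_comb (E_linop o i)) scaler_sumr; apply: eq_bigr => b _.
by rewrite EE eq_sym !scalerA mulrC.
Qed.

(** A submodule N of P gives the submodule N (x) k^d of M, which is 0 or everything; constant
    families bring the alternative back to N. *)
Lemma mult_space_simple : simple_mod P.
Proof.
split.
  have [[u u0] _] := M_simple.
  have [a ua] : exists a, tensor_iso u a != 0.
    apply/existsP; apply: contraR u0 => /existsPn ua; rewrite -[u]tensor_isoK.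
    apply/eqP/big1 => a _; have /negPn/eqP -> := ua a.
    exact: (linop0 (E_linop a o)).
  by exists (tensor_iso u a).
move=> N [N0 NL NA NV]; have NS : subspace N by [].
have [|M0|MT'] := M_simple.2 (fun u => forall a, N (tensor_iso u a)).
- split=> [a|c u v Nu Nv a|f u Nu a|eta u Nu a].
  + by rewrite (linop0 (tensor_iso_linop a)).
  + by rewrite tensor_iso_linop; apply: NL.
  + by rewrite tensor_iso_actA; apply: NA.
  rewrite tensor_iso_actV (tensVE rho0); apply: subspaceD => //; first exact: NV.
  apply: subspace_sum => // p _; apply: subspace_sum => // l _.
  by apply: subspace_sum => // b _; apply: subspaceZ => //; apply: NA.
- left=> p Np; have [u up] := tensor_iso_surj (fun _ => p).
  have u0 : u = 0 by apply: M0 => a; rewrite up.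
  have <- : tensor_iso u o = p by rewrite up.
  by rewrite u0 (linop0 (tensor_iso_linop o)).
- right=> p; have [u up] := tensor_iso_surj (fun _ => p).
  by have := MT' u o; rewrite up.
Qed.
End Decomposition.

Theorem theorem3p7 (k : closedFieldType) (n : nat)
    (char0 : [pchar k] =i pred0)
    (uncountable : ~ exists f : k -> nat, injective f)
    (M : AVmod k n) (M_simple : simple_mod M) (M_hol : holonomic M) :
  exists (P : AVmod k n) (d : nat) (rho : 'M[k]_n -> 'M[k]_d),
    [/\ is_Dmod P, simple_mod P, holonomic P,
        gl_rep rho /\ gl_simple rho &
        exists F : AVcar M -> 'I_d -> AVcar P, AV_iso_tensor rho F].
Proof.
have theta0 := simple_holonomic_theta char0 M_simple M_hol.
have [d [w [d_gt0 w_free w_stable w_min]]] := minimal_gl_stable char0 M_simple M_hol.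
have /fin_all_exists[c Hc] (ijb : 'I_n * 'I_n * 'I_d) := w_stable ijb.1.1 ijb.1.2 ijb.2.
pose R i j : 'M[k]_d := \matrix_(a, b) c (i, j, b) a.
have glop_w i j b : glop i j (w b) = \sum_a R i j a b *: w a.
  by rewrite (Hc (i, j, b)); apply: eq_bigr => a _; rewrite mxE.
have [E rE] := exists_matrix_units d_gt0 w_free w_min glop_w.
pose o := Ordinal d_gt0; pose rho := gl_matrix R.
have E_linop a b : linop (E a b) by apply: represents_linop (rE a b).
have EA a b f u : E a b (actA M f u) = actA M f (E a b u) by apply: representsA (rE a b) _ _.
have Ed a b p u : E a b (pder p u) = pder p (E a b u) by apply: represents_pder (rE a b) _ _.
have EE := matrix_units_mul M_simple theta0 d_gt0 w_free glop_w rE.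
have E1 := matrix_units_sum M_simple theta0 d_gt0 w_free glop_w rE.
have glopE := matrix_units_glop M_simple theta0 d_gt0 w_free glop_w rE.
have rho0 : rho 0 = 0 := linop0 (gl_matrix_linop R).
have rho_delta := gl_matrix_delta R.
exists (mult_space o E_linop EA Ed), d, rho.
have P_simple := mult_space_simple M_simple theta0 o E_linop EA Ed EE E1 glopE rho0 rho_delta.
split=> //.
- exact: fixed_module_Dmod.
- apply: (simple_holonomic char0 P_simple) => fs etas M0.
  apply: gk_exponent_fixed_le; rewrite (simple_holonomic_GKdim M_simple M_hol).
  exact: Rbar.Rbar_le_refl.
- by split; [apply: gl_matrix_rep glop_w | apply: gl_matrix_simple glop_w].
exists (tensor_iso o E_linop EA Ed EE); split.
- by move=> a u v i; apply: tensor_iso_linop.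
- exact: tensor_iso_inj.
- exact: tensor_iso_surj.
- exact: tensor_iso_actA.
- exact: tensor_iso_actV.
Qed.
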